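(* Let $0<\alpha<n$, $r\in(1,\infty)$, and $p(\cdot), q(\cdot)\in\mathbb{P}_{0}(0,\infty)$ be such that $0<p_{+},\,q_{+}<\frac{n}{\alpha}$. If $p_0\in(0,\min\{\frac{n}{n+\alpha},p_{-},q_{-}\})$, $\frac{1}{u(t)}:=\frac{1}{p(t)}-\frac{\alpha}{n}$ and $\frac{1}{v(t)}:=\frac{1}{q(t)}-\frac{\alpha}{n}$, then for any $\sigma>1/p_0$ there is a constant $C>0$ such that for any sequence of measurable functions $\{f_j\}_{j=1}^{\infty}$ on $\mathbb{R}^n$, \[ \left\|\left\{\sum_{j=1}^{\infty}(M_{\frac{\alpha}{\sigma}}f_j)^{r}\right\}^{1/r}\right\|_{\mathfrak{L}^{\sigma u(\cdot),\sigma v(\cdot)}(\mathbb{R}^n)}\le C\left\|\left\{\sum_{j=1}^{\infty}|f_j|^{r}\right\}^{1/r}\right\|_{\mathfrak{L}^{\sigma p(\cdot),\sigma q(\cdot)}(\mathbb{R}^n)}. \]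
   Context: A variable exponent on $(0,\infty)$ is a measurable function $p(\cdot):(0,\infty)\to(0,\infty)$; put $p_{-}=\operatorname{ess\,inf}_{t\in(0,\infty)}p(t)$ and $p_{+}=\operatorname{ess\,sup}_{t\in(0,\infty)}p(t)$. $\mathbb{P}_0(0,\infty)$ is the class of variable exponents with $0<p_{-}\le p_{+}<\infty$ for which the limits $p(0)=\lim_{t\to0^+}p(t)$ and $p(\infty)=\lim_{t\to\infty}p(t)$ exist and, for some constant $C>0$, $|p(t)-p(0)|\le \frac{C}{-\log t}$ for $0<t<\frac12$ and $|p(t)-p(\infty)|\le\frac{C}{\log(e+t)}$ for $0<t<\infty$. For measurable $f$ on $\mathbb{R}^n$, the non-increasing rearrangement is $f^{*}(t)=\inf\{s\ge 0: |\{x\in\mathbb{R}^n:|f(x)|>s\}|\le t\}$, $0<t<\infty$. Put $\rho_{p(\cdot),q(\cdot)}(f)=\int_0^\infty t^{\frac{q(t)}{p(t)}-1}[f^{*}(t)]^{q(t)}\,dt$. The variable Lorentz space $\mathfrak{L}^{p(\cdot),q(\cdot)}(\mathbb{R}^n)$ is the set of measurable $f$ with $\rho_{p(\cdot),q(\cdot)}(f)<\infty$, equipped with $\|f\|_{\mathfrak{L}^{p(\cdot),q(\cdot)}}=\inf\{\lambda>0:\rho_{p(\cdot),q(\cdot)}(f/\lambda)\le 1\}$ (equal to $\infty$ if no such $\lambda$ exists). For $0<\alpha<n$ the fractional maximal operator is $(M_\alpha f)(x)=\sup_{Q\ni x}|Q|^{\frac{\alpha}{n}-1}\int_Q|f(y)|\,dy$,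 the supremum being over all cubes $Q\subset\mathbb{R}^n$ containing $x$. *)

(* Defs.v *)
From HB Require Import structures.
From mathcomp Require Import all_boot all_order all_algebra.
From mathcomp Require Import all_classical all_reals all_analysis.
From mathcomp Require Import measurable_realfun ess_sup_inf.

Set Implicit Arguments.
Unset Strict Implicit.
Unset Printing Implicit Defensive.

Import Order.TTheory GRing.Theory Num.Theory.
Import numFieldNormedType.Exports.

Local Open Scope classical_set_scope.
Local Open Scope ring_scope.
Local Open Scope ereal_scope.

Section lebesgue_measure_Rn.
Context {R : realType}.

Definition tcons n (x : measurableTypeR R * n.-tuple (measurableTypeR R)) :
  n.+1.-tuple (measurableTypeR R) := [tuple of x.1 :: x.2].

Let measurable_tcons n : measurable_fun [set: _] (@tcons n).
Proof. exact: measurable_cons. Qed.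

(* n-fold product of the one-dimensional Lebesgue measure, on Borel sets. *)
Fixpoint borel_lebesgue_n n : set (n.-tuple (measurableTypeR R)) -> \bar R :=
  match n with
  | 0 => \d_ [tuple]
  | m.+1 => pushforward (@lebesgue_measure R \x @borel_lebesgue_n m) (@tcons m)
  end.

Let sigma_finite_pushforward n
    (m : {sigma_finite_measure set (n.-tuple (measurableTypeR R)) -> \bar R}) :
  sigma_finite [set: _] (pushforward (@lebesgue_measure R \x m) (@tcons n)).
Proof.
have /sigma_finiteP[F [TF ndF Foo]] := sigma_finiteT (@lebesgue_measure R).
have /sigma_finiteP[G [TG ndG Goo]] := sigma_finiteT m.
exists (fun k => [set y | F k (thead y) /\ G k [tuple of behead y]]).
  apply/esym; rewrite -subTset => y _.
  have [k1 _ Fy] : (\bigcup_i F i) (thead y) by rewrite -TF.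
  have [k2 _ Gy] : (\bigcup_i G i) [tuple of behead y] by rewrite -TG.
  exists (maxn k1 k2) => //; split.
    by apply: (subsetPset _ _ (ndF _ _ (leq_maxl k1 k2))).
  by apply: (subsetPset _ _ (ndG _ _ (leq_maxr k1 k2))).
move=> k; have [mF Fk] := Foo k; have [mG Gk] := Goo k; split.
  apply: measurableI; rewrite -[X in measurable X]setTI.
    exact: (@measurable_tnth _ (measurableTypeR R) n.+1 ord0).
  exact: (@measurable_behead _ (measurableTypeR R) n).
rewrite /pushforward (_ : _ @^-1` _ = F k `*` G k).
  by rewrite product_measure1E// lte_mul_pinfty// ge0_fin_numE.
apply/seteqP; split => -[a b];
  have ta : thead (tcons (a, b)) = a by [];
  have tb : [tuple of behead (tcons (a, b))] = b :> n.-tuple _ by exact/val_inj.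
  by move=> [/=]; rewrite ta tb.
by move=> [/= Fa Gb]; split; rewrite ?ta ?tb.
Qed.

Section sigma_finite_copy.
Context d (T : measurableType d) (m : {measure set T -> \bar R}).
Hypothesis m_sigma_finite : sigma_finite [set: T] m.
Let m' : set T -> \bar R := m.
HB.instance Definition _ := Measure.on m'.
HB.instance Definition _ :=
  Measure_isSigmaFinite.Build _ _ _ m' m_sigma_finite.
Lemma sigma_finite_copy : {m' : {sigma_finite_measure set T -> \bar R} |
  (m : set T -> \bar R) = m'}.
Proof. by exists m'. Qed.
End sigma_finite_copy.

Let borel_lebesgue_nP n :
  {m : {sigma_finite_measure set (n.-tuple (measurableTypeR R)) -> \bar R} |
    @borel_lebesgue_n n = m}.
Proof.
elim: n => [|n [m IH]] /=; first by exists (\d_ [tuple]).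
pose mu : {measure set _ -> \bar R} :=
  measure_function_pushforward__canonical__measure_function_Measure
    (@lebesgue_measure R \x m) (@measurable_tcons n).
have [m' mm'] := @sigma_finite_copy _ _ mu (sigma_finite_pushforward m).
by exists m'; rewrite IH -mm'.
Qed.

Section instances.
Variable n : nat.

Let mu0 : @borel_lebesgue_n n set0 = 0.
Proof. by have [m ->] := borel_lebesgue_nP n. Qed.

Let mu_ge0 A : 0 <= @borel_lebesgue_n n A.
Proof. by have [m ->] := borel_lebesgue_nP n. Qed.

Let mu_sigma_additive : semi_sigma_additive (@borel_lebesgue_n n).
Proof.
by have [m ->] := borel_lebesgue_nP n; exact: measure_semi_sigma_additive.
Qed.

HB.instance Definition _ := isMeasure.Build _ _ _ (@borel_lebesgue_n n)
  mu0 mu_ge0 mu_sigma_additive.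

Let mu_sigma_finite : sigma_finite [set: _] (@borel_lebesgue_n n).
Proof. by have [m ->] := borel_lebesgue_nP n; exact: sigma_finiteT. Qed.

HB.instance Definition _ := Measure_isSigmaFinite.Build _ _ _
  (@borel_lebesgue_n n) mu_sigma_finite.

End instances.
End lebesgue_measure_Rn.
Arguments borel_lebesgue_n R n : clear implicits.

(* R^n with its Lebesgue sigma-algebra, realized as the Caratheodory
   sigma-algebra of the outer measure induced by the Borel product measure. *)
Notation Rn R n := (caratheodory_type (mu_ext (borel_lebesgue_n R n))).

Definition lebesgue_n (R : realType) (n : nat) : set (Rn R n) -> \bar R :=
  @completed_measure_extension _ _ _ (borel_lebesgue_n R n).

HB.instance Definition _ (R : realType) (n : nat) :=
  Measure.on (@lebesgue_n R n).

HB.instance Definition _ (R : realType) (n : nat) :=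
  Measure_isSigmaFinite.Build _ _ _ (@lebesgue_n R n)
    (completed_measure_extension_sigma_finite
       (sigma_finiteT (borel_lebesgue_n R n))).

(* The real line with its Lebesgue (rather than Borel) sigma-algebra. *)
Notation R1 R := (caratheodory_type (mu_ext (@wlength R idfun))).

Notation lebesgue_1 R := (@completed_lebesgue_measure R).

Lemma measurable_pos (R : realType) :
  measurable (`]0%R, +oo[%classic : set (R1 R)).
Proof.
apply: (@sub_caratheodory _ _ _ (wlength idfun)).
exact: (@measurable_itv R `]0%R, +oo[).
Qed.

Section exponents.
Context {R : realType}.
Implicit Types p : R -> R.

Definition lebesgue_pos : set (R1 R) -> \bar R :=
  mrestr (lebesgue_1 R) (@measurable_pos R).

HB.instance Definition _ := Measure.on lebesgue_pos.

Definition exponent_inf p : \bar R := ess_inf lebesgue_pos (EFin \o p).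

Definition exponent_sup p : \bar R := ess_sup lebesgue_pos (EFin \o p).

(* A function on (0, +oo) is represented by a function on R of which only the
   values on (0, +oo) are ever used. *)
Definition variable_exponent p : Prop :=
  measurable_fun (`]0%R, +oo[%classic : set (R1 R)) (p : R1 R -> R) /\
  forall t : R, (0 < t -> 0 < p t)%R.

Definition P0 p : Prop :=
  [/\ variable_exponent p,
      0 < exponent_inf p, exponent_inf p <= exponent_sup p, exponent_sup p < +oo &
      exists a b : R,
        [/\ p t @[t --> (0 : R)^'+] --> a,
            p t @[t --> +oo%R] --> b &
            exists2 C : R, (0 < C)%R &
              (forall t : R, 0 < t < 2^-1 ->
                `|p t - a| <= C / - ln t)%R /\
              (forall t : R, 0 < t ->
                `|p t - b| <= C / ln (expR 1 + t))%R]].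

End exponents.

(* Functions on R^n are extended-real-valued, since a maximal function or an
   infinite sum may be +oo at some points. *)
Section lorentz.
Context {R : realType} {n : nat}.
Implicit Types f : Rn R n -> \bar R.

Definition rearrangement f (t : R) : \bar R :=
  ereal_inf [set s%:E | s in [set s : R |
    (0 <= s)%R /\ lebesgue_n [set x | s%:E < `|f x|] <= t%:E]].

Definition lorentz_modular (p q : R -> R) f : \bar R :=
  \int[lebesgue_1 R]_(t in `]0%R, +oo[%classic)
    ((t `^ (q t / p t - 1))%:E * (rearrangement f t) `^ (q t)).

(* The norm is +oo when no l qualifies, by ereal_inf set0 = +oo. *)
Definition lorentz_norm (p q : R -> R) f : \bar R :=
  ereal_inf [set l%:E | l in [set l : R |
    (0 < l)%R /\ lorentz_modular p q (fun x => l^-1%:E * f x) <= 1]].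

(* The cubes are those with sides parallel to the axes, nondegenerate (l > 0 is
   required where they are used); using open ones instead would not change the
   maximal function. *)
Definition cube (c : n.-tuple R) (l : R) : set (Rn R n) :=
  [set x | forall i, (tnth c i <= tnth (x : n.-tuple R) i <= tnth c i + l)%R].

Definition frac_maximal (a : R) f (x : Rn R n) : \bar R :=
  ereal_sup [set lebesgue_n Q `^ (a / n%:R - 1)
                 * \int[@lebesgue_n R n]_(y in Q) `|f y|
    | Q in [set Q | (exists c, exists2 l : R, (0 < l)%R & Q = cube c l)
                    /\ Q x]].

Definition lr_sum (r : R) (g : nat -> Rn R n -> \bar R) (x : Rn R n) : \bar R :=
  (\sum_(0 <= j <oo) g j x `^ r) `^ r^-1.

End lorentz.

(* The exponent u with 1/u(t) = 1/p(t) - alpha/n. It is positive wherever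
   p(t) < n/alpha; on a null set of t it may take a meaningless value. *)
Definition sobolev_exponent (R : realType) (n : nat) (alpha : R) (p : R -> R)
  (t : R) : R := ((p t)^-1 - alpha / n%:R)^-1%R.

(* Main.v *)
(** Minkowski's inequality in l^r, applied to a positive linear potential dominating every
    M_a f_j, reduces the vector-valued estimate to one for a discretised Riesz potential of
    F = (sum_j |f_j|^r)^(1/r). A weak-type argument (O'Neil's inequality) shows: if at the scale
    t the rearrangement F* lies below s (t/tau)^A for tau <= t and below s (t/tau)^B for
    tau >= t, where g := a/n < B and A < 1, then the rearrangement of the potential at t is at
    most C s t^g. On the shells ]e^(k-1), e^k] the modular of a nonincreasing function is, by
    the log-Hoelder conditions at 0 and at infinity, equivalent to a sum over k of
    (e^(k/p) F*(e^k))^q with p, q frozen to their limits at 0 or at infinity; smoothing these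
    sequences geometrically supplies the admissible s for every scale, and the larger exponent
    v >= q only helps since the sequences are bounded. *)

Require Import Defs.
From HB Require Import structures.
From mathcomp Require Import all_boot all_order all_algebra.
From mathcomp Require Import all_classical all_reals all_analysis.
From mathcomp Require Import measurable_realfun ess_sup_inf.
From mathcomp Require Import ring lra zify.

Import Order.TTheory GRing.Theory Num.Theory.
Import numFieldNormedType.Exports.

Local Open Scope classical_set_scope.
Local Open Scope ring_scope.
Local Open Scope ereal_scope.

(** Two obstacles shape the proof. A modular with variable exponents is not homogeneous, so a
    constant cannot be pulled out of it: the final constant is placed inside the function, and the
    weak-type estimate, homogeneous in the level [s], carries it through.

    The first exponent enters through its reciprocal [1/(sigma p)]: passing to [sigma u] then
    subtracts the constant [g = alpha/(sigma n)]. The admissible slopes are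
    [A = 1/(sigma p_-) + eps] and [B = 1/(sigma p_+) - eps]. For small [eps], [A < 1] comes from
    [sigma > 1/p0 > 1/p_-], and [g < B] from [p_+ < n/alpha]. The potential sums over cubes of
    volumes e^(t + k) with [t] free, so that small and large cubes can be separated exactly at the
    scale where the rearrangement is estimated. *)

(** * Comparison of integrals with step functions *)

Section integral_step.
Context d (T : measurableType d) (R : realType) (mu : {measure set T -> \bar R}).
Implicit Types (D : set T) (f g : T -> \bar R) (A : nat -> set T).

(** The integral of a nonnegative function is a supremum over the simple functions below it, so
    monotonicity needs no measurability. Integrands built from rearrangements and variable powers
    can thus be compared directly. *)
Lemma ge0_le_integral_nonmeas D f g : (forall x, D x -> 0 <= f x) ->
  (forall x, D x -> f x <= g x) -> \int[mu]_(x in D) f x <= \int[mu]_(x in D) g x.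
Proof.
move=> f0 fg; rewrite (integral_mkcond D f) (integral_mkcond D g).
have f0' x : 0 <= (f \_ D) x by exact: erestrict_ge0.
have fg' x : (f \_ D) x <= (g \_ D) x by apply: lee_restrict.
rewrite !ge0_integralTE//; last by move=> x; exact: le_trans (fg' x).
by apply: le_ereal_sup => _ [h hf <-]; exists h => // x; exact: le_trans (fg' x).
Qed.

Lemma integral_step (c : nat -> \bar R) A : (forall n, 0 <= c n) ->
  (forall n, measurable (A n)) ->
  \int[mu]_x (\sum_(n <oo) c n * (\1_(A n) x)%:E) = \sum_(n <oo) c n * mu (A n).
Proof.
move=> c0 mA; have mi n : measurable_fun [set: T] (fun x => (\1_(A n) x)%:E : \bar R).
  by apply/measurable_EFinP; exact: measurable_indic.
rewrite integral_nneseries//; last 2 first.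
- by move=> n; exact: measurable_funeM.
- by move=> n x _; rewrite mule_ge0// lee_fin.
by apply: eq_eseriesr => n _; rewrite ge0_integralZl// integral_indic// setIT.
Qed.

(** Removing the exceptional null set from every [A n] makes the bound pointwise without changing
    any measure; disjointness leaves at most one nonzero term at each point. *)
Lemma step_le_integral D f (c : nat -> \bar R) A :
  (forall x, D x -> 0 <= f x) -> (forall n, 0 <= c n) ->
  (forall n, measurable (A n)) -> trivIset setT A -> (forall n, A n `<=` D) ->
  {ae mu, forall x n, A n x -> c n <= f x} ->
  \sum_(n <oo) c n * mu (A n) <= \int[mu]_(x in D) f x.
Proof.
move=> f0 c0 mA tA AD [N [mN N0 sN]].
have mAN n : measurable (A n `\` N) by exact: measurableD.
rewrite (_ : \sum_(n <oo) _ = \sum_(n <oo) c n * mu (A n `\` N)); last first.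
  apply: eq_eseriesr => n _; congr (_ * _).
  have AN0 : mu (A n `&` N) = 0.
    by apply: (subset_measure0 _ mN) => //; exact: measurableI.
  by rewrite [LHS](measureDI mu (mA n) mN) [X in _ + X]AN0 adde0.
rewrite -integral_step// [leRHS]integral_mkcond; apply: ge0_le_integral_nonmeas => [x _|x _].
  by apply: nneseries_ge0 => n _ _; rewrite mule_ge0// lee_fin.
have [[n [Anx Nx]]|nA] := pselect (exists n, (A n `\` N) x); last first.
  rewrite eseries0; first exact: erestrict_ge0.
  move=> n _ _; rewrite indicE memNset ?mule0// => Anx.
  by apply: nA; exists n.
rewrite (@nneseriesD1 _ _ n)//; last by move=> k _; rewrite mule_ge0// lee_fin.
rewrite indicE mem_set// mule1 eseries0 ?adde0//.
  rewrite patchE mem_set; last exact: AD Anx.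
  by apply: contrapT => /negP h; apply: Nx; apply: sN => /= /(_ n Anx) /idP; exact/negP.
move=> k _ kn; rewrite indicE memNset ?mule0// => -[Akx _].
by move/eqP: kn; apply; apply: tA => //; exists x.
Qed.

(** The exceptional null set is added as one more step, of height +oo; it costs nothing because +oo
    times 0 is 0. *)
Lemma integral_le_step D f (c : nat -> \bar R) A :
  (forall x, D x -> 0 <= f x) -> (forall n, 0 <= c n) ->
  (forall n, measurable (A n)) -> D `<=` \bigcup_n A n ->
  {ae mu, forall x, forall n, A n x -> f x <= c n} ->
  \int[mu]_(x in D) f x <= \sum_(n <oo) c n * mu (A n).
Proof.
move=> f0 c0 mA DA [N [mN N0 sN]].
pose A' n := if n is m.+1 then A m else N.
pose c' n := if n is m.+1 then c m else +oo.
have c'0 n : 0 <= c' n by case: n => [|n] /=; rewrite ?leey.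
have mA' n : measurable (A' n) by case: n.
have cA0 n : 0 <= c n * mu (A n) by rewrite mule_ge0.
rewrite (_ : \sum_(n <oo) _ = \sum_(n <oo) c' n * mu (A' n)); last first.
  rewrite [RHS]nneseries_recl//; last by move=> k _; rewrite mule_ge0.
  rewrite /= N0 mule0 add0e -(@nneseries_addn _ (fun n => c' n * mu (A' n)) 1)//; last by move=> i; rewrite mule_ge0.
  by apply: eq_eseriesr => n _; rewrite addn1.
rewrite -integral_step// [leLHS]integral_mkcond; apply: ge0_le_integral_nonmeas => [x _|x _].
  exact: erestrict_ge0.
have p0 n : 0 <= c' n * (\1_(A' n) x)%:E by rewrite mule_ge0// lee_fin.
rewrite patchE; case: ifPn => [|_]; last exact: nneseries_ge0.
rewrite inE => /DA[n _ Anx].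
have [Nx|Nx] := pselect (N x).
  rewrite (@nneseriesD1 _ _ 0%N)// /= indicE mem_set// mule1 addye ?leey//.
  by rewrite gt_eqF// (@lt_le_trans _ _ 0)// nneseries_ge0.
rewrite (@nneseriesD1 _ _ n.+1)// /= indicE mem_set// mule1.
rewrite (@le_trans _ _ (c n))// ?leeDl ?nneseries_ge0//.
by apply: contrapT => /negP h; apply: Nx; apply: sN => /= /(_ n Anx) /idP; exact/negP.
Qed.

End integral_step.

(** * Duality in l^r and Minkowski's inequality *)

Section hoelder_finite.
Context {R : realType}.
Implicit Types (r : R) (a b : nat -> R).

(* The duality pairing of l^r with l^r': if A is the l^r norm of a, the weights
   [(a i / A)^(r-1)] have l^r' norm 1. *)
Lemma hoelder_dual r a b N (A : R) : (1 < r)%R ->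
  (forall i, 0 <= a i)%R -> (forall i, 0 <= b i)%R ->
  (0 < A)%R -> (A `^ r = \sum_(i < N) a i `^ r)%R ->
  (\sum_(i < N) (a i / A) `^ (r - 1) * b i <= (\sum_(i < N) b i `^ r) `^ r^-1)%R.
Proof.
move=> r1 a0 b0 A0 Ar; set B := (X in (_ <= X)%R).
have r0 : (0 < r)%R by exact: lt_trans r1.
have rN0 : r != 0%R by rewrite gt_eqF.
have sb0 : (0 <= \sum_(i < N) b i `^ r)%R by apply: sumr_ge0 => i _; exact: powR_ge0.
have [B0|BN0] := eqVneq B 0%R.
  rewrite B0 big1// => i _.
  have /eqP : B = 0%R := B0.
  rewrite powR_eq0 => /andP[/eqP/psumr_eq0P h _].
  have /eqP : (b i `^ r = 0)%R by apply: h => // k _; exact: powR_ge0.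
  by rewrite powR_eq0 => /andP[/eqP -> _]; rewrite mulr0.
have B0 : (0 < B)%R by rewrite lt_neqAle eq_sym BN0 powR_ge0.
have Br : (B `^ r = \sum_(i < N) b i `^ r)%R by rewrite -powRrM mulVf// powRr1.
clearbody B; rewrite -[leRHS]mul1r -ler_pdivrMr// mulr_suml.
have rr1 : (0 < r - 1)%R by rewrite subr_gt0.
have [r' r'E] : exists r', (r' = r / (r - 1))%R by eexists.
have r'0 : (0 < r')%R by rewrite r'E divr_gt0.
have rr' : (r'^-1 + r^-1 = 1)%R.
  by rewrite r'E invf_div -[X in (_ + X)%R]div1r -mulrDl subrK divff.
have r'r : ((r - 1) * r' = r)%R by rewrite r'E mulrC divfK// gt_eqF.
(* Young's inequality in each term, [b] being normalised by its own norm [B]. Both normalised power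
   sums equal 1, so the total is 1/r' + 1/r = 1. *)
apply: (@le_trans _ _ (\sum_(i < N) ((a i / A) `^ r / r' + (b i / B) `^ r / r))%R).
  apply: ler_sum => i _; rewrite -mulrA.
  rewrite -{2}r'r powRrM; apply: conjugate_powR; rewrite ?powR_ge0//.
  by rewrite divr_ge0// ltW.
rewrite big_split/= -!mulr_suml.
have key (c : nat -> R) (C : R) : (forall i, 0 <= c i)%R -> (0 < C)%R ->
    (C `^ r = \sum_(i < N) c i `^ r)%R -> (\sum_(i < N) (c i / C) `^ r = 1)%R.
  move=> c0 C0 Cr; under eq_bigr do rewrite powRM ?invr_ge0 ?(ltW C0)//.
  by rewrite -mulr_suml -Cr -powRM ?invr_ge0 ?(ltW C0)// divff ?powR1// gt_eqF.
by rewrite (key a)// (key b)// !mul1r rr'.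
Qed.

End hoelder_finite.

Section minkowski_lr.
Context {R : realType} (T : Type).
Implicit Types (r : R) (f : nat -> T -> \bar R) (a : nat -> \bar R).

Lemma le_poweR r (x y : \bar R) : (0 <= r)%R -> 0 <= x -> x <= y -> x `^ r <= y `^ r.
Proof.
move=> r0 x0 xy; apply: gt0_ler_poweR => //; rewrite in_itv/= leey andbT//.
exact: le_trans xy.
Qed.

Lemma lr_ge_term r (b : nat -> \bar R) i : (0 < r)%R -> (forall j, 0 <= b j) ->
  b i <= (\sum_(0 <= j <oo) b j `^ r) `^ r^-1.
Proof.
move=> r0 b0; rewrite -{1}(poweRe1 (b0 i)) -(@mulfV _ r) ?gt_eqF// poweRrM.
apply: le_poweR; rewrite ?invr_ge0 ?(ltW r0) ?poweR_ge0//.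
rewrite (@nneseriesD1 _ _ i)//; last by move=> j _; exact: poweR_ge0.
by rewrite leeDl// nneseries_ge0// => j _ _; exact: poweR_ge0.
Qed.

(** By duality: [a j] stands for the value of a positive linear functional at [f j], and [B] for its
    value at the l^r norm of the family. The hypothesis records all that is used of the
    functional. *)
Lemma minkowski_lr r f a (B : \bar R) : (1 < r)%R ->
  (forall j x, 0 <= f j x) -> (forall j, 0 <= a j) ->
  (forall N (w : nat -> R), (forall j, 0 <= w j)%R ->
    (forall x, \sum_(j < N) (w j)%:E * f j x <=
       (\sum_(0 <= j <oo) f j x `^ r) `^ r^-1) ->
    \sum_(j < N) (w j)%:E * a j <= B) ->
  (\sum_(0 <= j <oo) a j `^ r) `^ r^-1 <= B.
Proof.
move=> r1 f0 a0 H.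
have r0 : (0 < r)%R by exact: lt_trans r1.
have rN0 : r != 0%R by rewrite gt_eqF.
(* A single unit weight bounds each [a i]; once [B] is finite, the rest is real arithmetic. *)
have aB i : a i <= B.
  pose w k : R := (k == i)%:R.
  have wE (g : nat -> \bar R) : \sum_(j < i.+1) (w j)%:E * g j = g i.
    rewrite big_ord_recr/= /w eqxx mul1e big1 ?add0e// => j _.
    by rewrite ltn_eqF// mulr0n mul0e.
  rewrite -(wE a); apply: H => [j|x]; first by rewrite /w; case: (_ == _).
  by rewrite (wE (f ^~ x)); exact: (@lr_ge_term r (f ^~ x) i r0).
have B0 : 0 <= B by exact: le_trans (aB 0%N).
case: B B0 aB H => [B|_ _ _|//]; last by rewrite leey.
rewrite lee_fin => B0 aB H.
have afin i : a i = (fine (a i))%:E.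
  by rewrite fineK// ge0_fin_numE// (le_lt_trans (aB i))// ltry.
pose b i := fine (a i).
have b0 i : (0 <= b i)%R by exact: fine_ge0.
have SN N : (\sum_(i < N) b i `^ r <= B `^ r)%R.
  set S := (X in (X <= _)%R).
  have S0 : (0 <= S)%R by apply: sumr_ge0 => i _; exact: powR_ge0.
  have [->|SN0] := eqVneq S 0%R; first exact: powR_ge0.
  have [A AE] : exists A, A = (S `^ r^-1)%R by eexists.
  have A0 : (0 < A)%R by rewrite AE powR_gt0// lt_neqAle eq_sym SN0.
  have Ar : (A `^ r = S)%R by rewrite AE -powRrM mulVf// powRr1.
  rewrite -Ar; apply: ge0_ler_powR; rewrite ?nnegrE ?(ltW A0)// ?(ltW r0)//.
  rewrite -lee_fin.
  (* Weights of l^r' norm 1 whose pairing with [b] is exactly [A]. *)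
  pose w i := ((b i / A) `^ (r - 1))%R.
  have -> : A%:E = \sum_(j < N) (w j)%:E * a j.
    under eq_bigr do rewrite afin -EFinM.
    rewrite sumEFin; congr (_%:E).
    transitivity (\sum_(i < N) b i `^ r * A `^ (1 - r))%R.
      rewrite -mulr_suml -/S -Ar -powRD.
        by rewrite addrCA subrr addr0 powRr1// ltW.
      by rewrite addrCA subrr addr0 gt_eqF// implybT.
    apply: eq_bigr => i _; rewrite /w -/(b i) powRM// ?invr_ge0 ?(ltW A0)//.
    rewrite -(powR_inv1 (ltW A0)) -powRrM mulN1r opprB mulrAC; congr (_ * _)%R.
    by rewrite mulrC mulr_powRB1.
  apply: H => [j|x]; first exact: powR_ge0.
  have [->|FN] := eqVneq ((\sum_(0 <= j <oo) f j x `^ r) `^ r^-1) +oo; first by rewrite leey.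
  have ffin i : f i x = (fine (f i x))%:E.
    rewrite fineK// ge0_fin_numE// (le_lt_trans (@lr_ge_term r (f ^~ x) i r0 (f0 ^~ x)))//.
    by rewrite ltey.
  under eq_bigr do rewrite ffin -EFinM.
  rewrite sumEFin; set c := fun i => fine (f i x).
  have c0 i : (0 <= c i)%R by exact: fine_ge0.
  have := @hoelder_dual _ r b c N A r1 b0 c0 A0 Ar; rewrite -lee_fin => /le_trans; apply.
  rewrite -poweR_EFin; apply: le_poweR; rewrite ?invr_ge0 ?(ltW r0)// ?lee_fin.
    by apply: sumr_ge0 => i _; exact: powR_ge0.
  rewrite -sumEFin; under eq_bigr do rewrite -poweR_EFin /c -ffin.
  rewrite -(big_mkord xpredT (fun i => f i x `^ r)).
  by apply: nneseries_lim_ge => i _ _; exact: poweR_ge0.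
have Bfin : B%:E = (B `^ r)%:E `^ r^-1 by rewrite poweR_EFin -powRrM mulfV// powRr1.
rewrite Bfin; apply: le_poweR; rewrite ?invr_ge0 ?(ltW r0)//.
  by apply: nneseries_ge0 => i _ _; exact: poweR_ge0.
apply: lime_le; first by apply: is_cvg_nneseries => i _ _; exact: poweR_ge0.
apply: nearW => N; rewrite big_mkord; under eq_bigr do rewrite afin poweR_EFin.
by rewrite sumEFin lee_fin.
Qed.

End minkowski_lr.

(** * Cubes and potentials *)

Section Rn_measure.
Context {R : realType}.

Lemma measurable_Rn n (A : set (n.-tuple (measurableTypeR R))) :
  measurable A -> measurable (A : set (Rn R n)).
Proof. exact: caratheodory_measurable_mu_ext. Qed.

Lemma measurable_coord n (i : 'I_n) :
  measurable_fun [set: Rn R n] ((fun x => tnth (x : n.-tuple R) i) : Rn R n -> R).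
Proof.
move=> _ Y mY; rewrite setTI; apply: measurable_Rn.
rewrite -[X in measurable X]setTI.
exact: (@measurable_tnth _ (measurableTypeR R) n i measurableT Y mY).
Qed.

Lemma lebesgue_nE n (A : set (n.-tuple (measurableTypeR R))) :
  measurable A -> lebesgue_n (A : set (Rn R n)) = borel_lebesgue_n R n A.
Proof. by move=> mA; rewrite /lebesgue_n /completed_measure_extension measurable_mu_extE. Qed.

Lemma le_lebesgue_n n (A B : set (Rn R n)) : A `<=` B -> lebesgue_n A <= lebesgue_n B.
Proof. by move=> AB; apply: (le_mu_ext (borel_lebesgue_n R n)). Qed.

Lemma measurable_cube_borel n (c : n.-tuple R) (l : R) :
  measurable (cube c l : set (n.-tuple (measurableTypeR R))).
Proof.
rewrite /cube (_ : mkset _ = \bigcap_(i in [set: 'I_n])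
   ((fun x : n.-tuple (measurableTypeR R) => tnth x i) @^-1` `[tnth c i, (tnth c i + l)%R])); last first.
  by apply/seteqP; split=> x /= h i; [move=> _|]; have := h i; rewrite /= in_itv/=; last exact.
apply: fin_bigcap_measurable => // i _; rewrite -[X in measurable X]setTI.
by apply: (@measurable_tnth _ (measurableTypeR R) n i).
Qed.

Lemma measurable_cube n (c : n.-tuple R) (l : R) : measurable (cube c l).
Proof. by apply: measurable_Rn; exact: measurable_cube_borel. Qed.

Lemma lebesgue_n_cube n (c : n.-tuple R) (l : R) : (0 <= l)%R ->
  lebesgue_n (cube c l) = (l ^+ n)%:E.
Proof.
move=> l0; rewrite lebesgue_nE; last exact: measurable_cube_borel.
elim: n c => [|n IH] c.
  by rewrite /= expr0 diracE mem_set// => -[].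
rewrite /= /pushforward (_ : _ @^-1` _ = `[thead c, (thead c + l)%R]%classic `*` cube [tuple of behead c] l).
  transitivity (lebesgue_measure `[thead c, (thead c + l)%R]%classic *
      borel_lebesgue_n R n (cube [tuple of behead c] l)).
    by apply: product_measure1E => //; exact: measurable_cube_borel.
  rewrite IH lebesgue_measure_itv/= lte_fin ltrDl exprS EFinM.
  have [l1|l1] := ltP 0%R l; first by rewrite -EFinD addrAC subrr add0r.
  by rewrite (_ : l = 0%R)//; apply/eqP; rewrite eq_le l1 l0.
apply/seteqP; split=> -[a b] /=.
  move=> h; split; first by have := h ord0; rewrite in_itv.
  move=> i; have := h (lift ord0 i).
  by rewrite !(tnth_nth 0%R)/= nth_behead.
rewrite in_itv /= => -[h1 h2] i.
case: (unliftP ord0 i) => [j|] ->//.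
have := h2 j.
by rewrite !(tnth_nth 0%R)/= nth_behead.
Qed.

End Rn_measure.
Section centred_cube.
Context {R : realType} {n : nat}.
Implicit Types (s t : R) (x y : Rn R n) (f : Rn R n -> \bar R).

(* The cube of centre x and of volume [expR s]. *)
Definition centred_cube s x : set (Rn R n) :=
  [set y : Rn R n | forall i : 'I_n, (`|tnth (y : n.-tuple R) i - tnth (x : n.-tuple R) i|
     <= expR (s / n%:R) / 2)%R].

Lemma centred_cubeE s x : centred_cube s x =
  cube [tuple (tnth (x : n.-tuple R) i - expR (s / n%:R) / 2)%R | i < n] (expR (s / n%:R)).
Proof.
apply/seteqP; split=> y /= h i; have := h i; rewrite tnth_mktuple ler_norml.
  by move=> /andP[? ?]; apply/andP; split; lra.
by move=> /andP[? ?]; apply/andP; split; lra.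
Qed.

Lemma measurable_centred_cube s x : measurable (centred_cube s x).
Proof. by rewrite centred_cubeE; exact: measurable_cube. Qed.

Lemma centred_cubeC s x y : centred_cube s x y = centred_cube s y x.
Proof. by apply/propext; split => h i; rewrite distrC. Qed.

Lemma lebesgue_n_centred_cube s x : (0 < n)%N ->
  lebesgue_n (centred_cube s x) = (expR s)%:E.
Proof.
move=> n0; rewrite centred_cubeE lebesgue_n_cube ?expR_ge0// -expRM_natr.
by rewrite divfK// pnatr_eq0 -lt0n.
Qed.

Lemma measurable_centred_cube_pair s :
  measurable [set z : Rn R n * Rn R n | centred_cube s z.1 z.2].
Proof.
rewrite (_ : mkset _ = \bigcap_(i in [set: 'I_n])
   ((fun z : Rn R n * Rn R n => `|tnth (z.2 : n.-tuple R) i - tnth (z.1 : n.-tuple R) i|)%R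
     @^-1` `]-oo, (expR (s / n%:R) / 2)%R]%classic)); last first.
  by apply/seteqP; split=> x /= h i; [move=> _|]; have := h i; rewrite /= in_itv/=; last exact.
apply: fin_bigcap_measurable => // i _; rewrite -[X in measurable X]setTI.
have mf : measurable_fun [set: Rn R n * Rn R n]
    (fun z => `|tnth (z.2 : n.-tuple R) i - tnth (z.1 : n.-tuple R) i|%R).
  apply: measurableT_comp => //.
  apply: (@measurable_funB _ _ _ _ (fun z : Rn R n * Rn R n => tnth (z.2 : n.-tuple R) i)
     (fun z => tnth (z.1 : n.-tuple R) i)).
    by apply: (measurableT_comp (@measurable_coord R n i)); exact: measurable_snd.
  by apply: (measurableT_comp (@measurable_coord R n i)); exact: measurable_fst.
by apply: mf => //; exact: measurable_itv.
Qed.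

(** Tonelli's theorem and the symmetry of lying in each other's centred cube: every point [y] is
    counted with the volume [expR s] of its own cube. This symmetry is the advantage of centred
    cubes. *)
Lemma integral_centred_cube s f : (0 < n)%N ->
  measurable_fun [set: Rn R n] f -> (forall x, 0 <= f x) ->
  \int[@lebesgue_n R n]_x \int[@lebesgue_n R n]_(y in centred_cube s x) f y =
  (expR s)%:E * \int[@lebesgue_n R n]_y f y.
Proof.
move=> n0 mf f0.
pose g (z : Rn R n * Rn R n) :=
  f z.2 * (\1_[set z : Rn R n * Rn R n | centred_cube s z.1 z.2] z)%:E.
have mg : measurable_fun [set: Rn R n * Rn R n] g.
  apply: emeasurable_funM; first exact: (measurableT_comp mf (@measurable_snd _ _ (Rn R n) (Rn R n))).
  by apply/measurable_EFinP; apply: measurable_indic; exact: measurable_centred_cube_pair.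
have g0 z : 0 <= g z by rewrite mule_ge0// lee_fin.
transitivity (\int[@lebesgue_n R n]_x \int[@lebesgue_n R n]_y g (x, y)).
  apply: eq_integral => x _; rewrite integral_mkcond; apply: eq_integral => y _.
  rewrite patchE /g indicE /=; have [h|h] := pselect (centred_cube s x y).
    by rewrite !mem_set// mule1.
  by rewrite !memNset// mule0.
rewrite (fubini_tonelli g mg g0).
transitivity (\int[@lebesgue_n R n]_y ((expR s)%:E * f y)); last first.
  by rewrite ge0_integralZl// lee_fin expR_ge0.
apply: eq_integral => y _.
transitivity (\int[@lebesgue_n R n]_x (f y * (\1_(centred_cube s y) x)%:E)).
  apply: eq_integral => x _; rewrite /g !indicE.
  have [h|h] := pselect (centred_cube s y x).
    by rewrite !mem_set//= centred_cubeC.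
  by rewrite !memNset//= centred_cubeC.
have mi : measurable_fun [set: Rn R n] (fun x => (\1_(centred_cube s y) x)%:E : \bar R).
  by apply/measurable_EFinP; apply: measurable_indic; exact: measurable_centred_cube.
have i0 (x : Rn R n) : 0 <= (\1_(centred_cube s y) x)%:E :> \bar R by rewrite lee_fin.
rewrite (@ge0_integralZl _ _ _ (@lebesgue_n R n) _ measurableT _ mi (f y)
  (fun x _ => i0 x) (f0 y)).
rewrite integral_indic//; last exact: measurable_centred_cube.
by rewrite setIT muleC; congr (_ * _); exact: lebesgue_n_centred_cube.
Qed.

End centred_cube.

(** * Domination of maximal functions by a potential *)

Section potential.
Context {R : realType} {n : nat}.
Hypothesis n_gt0 : (0 < n)%N.
Implicit Types (g s t : R) (x y : Rn R n) (f : Rn R n -> \bar R).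
Local Notation mu := (@lebesgue_n R n).

(** The quantity under the supremum of the maximal function of order [g = a/n], for the centred cube
    of volume [expR s]. *)
Definition avg g s f x : \bar R :=
  (expR ((g - 1) * s))%:E * \int[mu]_(y in centred_cube s x) f y.

(* A discretised Riesz potential: up to constants, the convolution of f with the kernel
   [|x|^(n g - n)], the cubes having volumes [e^(t - i)] and [e^(t + i + 1)]. *)
Definition potential g t f x : \bar R :=
  \sum_(0 <= i <oo) avg g (t - i%:R) f x + \sum_(0 <= i <oo) avg g (t + i.+1%:R) f x.

Lemma avg_ge0 g s f x : (forall y, 0 <= f y) -> 0 <= avg g s f x.
Proof. by move=> f0; rewrite mule_ge0 ?lee_fin ?expR_ge0// integral_ge0. Qed.

Lemma potential_ge0 g t f x : (forall y, 0 <= f y) -> 0 <= potential g t f x.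
Proof. by move=> f0; rewrite adde_ge0// nneseries_ge0// => i _ _; exact: avg_ge0. Qed.

Lemma le_avg g s f f' x : (forall y, 0 <= f y) -> (forall y, f y <= f' y) ->
  avg g s f x <= avg g s f' x.
Proof.
move=> f0 ff'; rewrite lee_wpmul2l ?lee_fin ?expR_ge0//.
by apply: ge0_le_integral_nonmeas => y _.
Qed.

Lemma le_potential g t f f' x : (forall y, 0 <= f y) -> (forall y, f y <= f' y) ->
  potential g t f x <= potential g t f' x.
Proof.
move=> f0 ff'; apply: leeD; apply: lee_nneseries => i *; by [exact: avg_ge0|exact: le_avg].
Qed.

Lemma avg_sum g s (N : nat) (w : nat -> R) (h : nat -> Rn R n -> \bar R) x :
  (forall j, 0 <= w j)%R -> (forall j y, 0 <= h j y) ->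
  (forall j, measurable_fun [set: Rn R n] (h j)) ->
  avg g s (fun y => \sum_(j < N) (w j)%:E * h j y) x =
  \sum_(j < N) (w j)%:E * avg g s (h j) x.
Proof.
move=> w0 h0 mh; have mc := measurable_centred_cube s x.
have mhc j : measurable_fun (centred_cube s x) (h j) by exact: measurable_funTS.
have wh0 j y : 0 <= (w j)%:E * h j y by rewrite mule_ge0// lee_fin.
have mwh j : measurable_fun (centred_cube s x) (fun y => (w j)%:E * h j y).
  exact: measurable_funeM.
rewrite /avg (@ge0_integral_sum _ _ _ mu _ mc 'I_N _
  (fun j => mwh j) (fun j y _ => wh0 j y)).
rewrite ge0_sume_distrr; last by move=> j _; rewrite integral_ge0// => y _; rewrite mule_ge0// lee_fin.
by apply: eq_bigr => j _; rewrite ge0_integralZl// ?lee_fin// muleCA.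
Qed.

Lemma potential_sum g t (N : nat) (w : nat -> R) (h : nat -> Rn R n -> \bar R) x :
  (forall j, 0 <= w j)%R -> (forall j y, 0 <= h j y) ->
  (forall j, measurable_fun [set: Rn R n] (h j)) ->
  potential g t (fun y => \sum_(j < N) (w j)%:E * h j y) x =
  \sum_(j < N) (w j)%:E * potential g t (h j) x.
Proof.
move=> w0 h0 mh; rewrite /potential.
have wa0 s (i j : nat) : 0 <= (w j)%:E * avg g s (h j) x.
  by rewrite mule_ge0 ?lee_fin// avg_ge0.
have split_series (s : nat -> R) :
    \sum_(0 <= i <oo) avg g (s i) (fun y => \sum_(j < N) (w j)%:E * h j y) x =
    \sum_(j < N) (w j)%:E * \sum_(0 <= i <oo) avg g (s i) (h j) x.
  under eq_eseriesr do rewrite avg_sum//.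
  rewrite nneseries_sum; last by move=> i j _; exact: wa0.
  by apply: eq_bigr => j _; rewrite nneseriesZl// => i _; exact: avg_ge0.
rewrite !split_series -big_split/=; apply: eq_bigr => j _.
by rewrite ge0_muleDr// nneseries_ge0// => i _ _; exact: avg_ge0.
Qed.

Lemma avg_le_potential g t (k : int) f x : (forall y, 0 <= f y) ->
  avg g (t + k%:~R) f x <= potential g t f x.
Proof.
move=> f0; have [k0|k0] := leP k 0%R.
  apply: (@le_trans _ _ (\sum_(0 <= i <oo) avg g (t - i%:R) f x)); last first.
    by rewrite leeDl// nneseries_ge0// => i _ _; exact: avg_ge0.
  have -> : (t + k%:~R = t - `|k|%N%:R)%R.
    by case: k k0 => [[|m]|m] //= _; rewrite ?subr0 ?addr0// NegzE mulrNz.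
  rewrite (@nneseriesD1 _ _ `|k|%N)//; last by move=> i _; exact: avg_ge0.
  by rewrite leeDl// nneseries_ge0// => i _ _; exact: avg_ge0.
apply: (@le_trans _ _ (\sum_(0 <= i <oo) avg g (t + i.+1%:R) f x)); last first.
  by rewrite leeDr// nneseries_ge0// => i _ _; exact: avg_ge0.
have -> : (t + k%:~R = t + `|k|%N.-1.+1%:R)%R.
  by case: k k0 => [[|m]|m].
rewrite (@nneseriesD1 _ _ `|k|%N.-1)//; last by move=> i _; exact: avg_ge0.
by rewrite leeDl// nneseries_ge0// => i _ _; exact: avg_ge0.
Qed.

(** A cube of side [l] through [x] lies in the centred cube of side [2 l], whose volume is rounded
    up to the next e^(t + k). The volume grows by at most the factor 2^n e, which enters with the
    power [1 - g]. *)
Definition dominationC g : R := expR ((1 - g) * (1 + n%:R * ln 2)).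

Lemma frac_maximal_le_potential (a t : R) f x : (a < n%:R)%R ->
  frac_maximal a f x <=
  (dominationC (a / n%:R))%:E * potential (a / n%:R) t (fun y => `|f y|) x.
Proof.
move=> an; set g := (a / n%:R)%R.
have nR0 : (0 < n%:R :> R)%R by rewrite ltr0n.
have g1 : (g < 1)%R by rewrite ltr_pdivrMr// mul1r.
apply: ge_ereal_sup => _ [Q [[c [l l0 ->]] Qx] <-].
rewrite lebesgue_n_cube ?(ltW l0)// poweR_EFin.
pose L := (n%:R * ln (2 * l))%R.
pose k := Num.ceil (L - t).
have /andP[k1 k2] := ceil_itv (L - t); rewrite -/k in k1 k2.
rewrite intrD/= mulrN1z in k1.
set s := (t + k%:~R)%R.
have lnL : L = (n%:R * ln 2 + n%:R * ln l)%R by rewrite /L lnM ?posrE// mulrDr.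
have sub : cube c l `<=` centred_cube s x.
  move=> y Qy i; have := Qy i; have := Qx i => /andP[x1 x2] /andP[y1 y2].
  apply: (@le_trans _ _ l); first by rewrite ler_norml; apply/andP; split; lra.
  rewrite ler_pdivlMr// mulrC -[leLHS](@lnK _ (2 * l)%R) ?posrE ?mulr_gt0//.
  rewrite ler_expR ler_pdivlMr// mulrC.
  by rewrite -/L /s; lra.
apply: (@le_trans _ _ ((dominationC g)%:E * avg g s (fun y => `|f y|) x)); last first.
  by rewrite lee_wpmul2l ?lee_fin ?expR_ge0// avg_le_potential.
rewrite /avg muleA -EFinM; apply: lee_pmul.
- by rewrite lee_fin powR_ge0.
- exact: integral_ge0.
- rewrite lee_fin -/g -[in leLHS](lnK (x := l)) ?posrE// -expRM_natl -expRM /dominationC -expRD ler_expR.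
  have : (0 <= (1 - g) * (L + 1 - s))%R by rewrite mulr_ge0 /s; lra.
  by rewrite lnL; lra.
rewrite [leLHS]integral_mkcond [leRHS]integral_mkcond.
apply: ge0_le_integral_nonmeas => y _; first exact: erestrict_ge0.
rewrite !patchE; have [Qy|Qy] := pselect (cube c l y).
  by rewrite !mem_set//; exact: sub.
by rewrite (memNset Qy); case: ifPn => _; rewrite ?abse_ge0.
Qed.

Lemma lr_sum_frac_maximal_le (a r t : R) (f : nat -> Rn R n -> \bar R) x :
  (a < n%:R)%R -> (1 < r)%R -> (forall j, measurable_fun [set: Rn R n] (f j)) ->
  lr_sum r (fun j => frac_maximal a (f j)) x <=
  (dominationC (a / n%:R))%:E *
    potential (a / n%:R) t (lr_sum r (fun j y => `|f j y|)) x.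
Proof.
move=> an r1 mf; set g := (a / n%:R)%R; set K := dominationC g.
have K0 : (0 <= K)%R by exact: expR_ge0.
have r0 : (0 < r)%R by lra.
pose b j := K%:E * potential g t (fun y => `|f j y|) x.
have b0 j : 0 <= b j by rewrite mule_ge0 ?lee_fin// potential_ge0.
apply: (@le_trans _ _ ((\sum_(0 <= j <oo) b j `^ r) `^ r^-1)).
  have fm0 j : 0 <= frac_maximal a (f j) x.
    apply: (@le_trans _ _ (lebesgue_n (cube (x : n.-tuple R) 1) `^ (a / n%:R - 1)
                 * \int[mu]_(y in cube (x : n.-tuple R) 1) `|f j y|)).
      by rewrite mule_ge0 ?poweR_ge0// integral_ge0.
    apply: ereal_sup_ubound; exists (cube (x : n.-tuple R) 1) => //; split.
      by exists x, 1%R.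
    by move=> i; rewrite lexx lerDl ler01.
  apply: le_poweR; rewrite ?invr_ge0 ?(ltW r0)//.
    by apply: nneseries_ge0 => j _ _; exact: poweR_ge0.
  apply: lee_nneseries => [j _ _|j _]; first exact: poweR_ge0.
  by apply: le_poweR; rewrite ?(ltW r0)//; exact: frac_maximal_le_potential.
(* The functional is a multiple of the potential at the fixed point [x], which is monotone and
   linear on finite positive combinations. *)
apply: (@minkowski_lr _ _ r (fun j y => `|f j y|)) => // N w w0 wF.
rewrite [leLHS](_ : _ = K%:E * potential g t (fun y => \sum_(j < N) (w j)%:E * `|f j y|) x).
  rewrite lee_wpmul2l ?lee_fin//; apply: le_potential => y; last exact: wF.
  by apply: sume_ge0 => j _; rewrite mule_ge0// lee_fin.
transitivity (K%:E * \sum_(j < N) (w j)%:E * potential g t (fun y => `|f j y|) x).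
  rewrite ge0_sume_distrr; first by apply: eq_bigr => j _; rewrite muleCA.
  by move=> j _; rewrite mule_ge0 ?lee_fin// potential_ge0.
have mh j : measurable_fun [set: Rn R n] (fun y => `|f j y|).
  exact: (measurableT_comp (@abse_measurable R _) (mf j)).
have h0 (j : nat) (y : Rn R n) : 0 <= `|f j y| by exact: abse_ge0.
by congr (_ * _); rewrite (potential_sum g t N w (fun j y => `|f j y|) x w0 h0 mh).
Qed.

End potential.

(** * Geometric series of ratio [expR (- d)] *)

Section geometric_sums.
Context {R : realType}.
Implicit Types (d b : R).

Definition geom d : R := ((1 - expR (- d))^-1)%R.

Lemma geom_gt0 d : (0 < d)%R -> (0 < geom d)%R.
Proof. by move=> d0; rewrite invr_gt0 subr_gt0 expR_lt1 oppr_lt0. Qed.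

Lemma nneseries_expR d : (0 < d)%R ->
  \sum_(0 <= i <oo) (expR (- (d * i%:R)))%:E = (geom d)%:E.
Proof.
move=> d0; apply/cvg_lim => //.
rewrite (_ : (fun _ => _) = EFin \o series (geometric 1%R (expR (- d)))); last first.
  apply/funext => N /=; rewrite -sumEFin; apply: eq_bigr => i _.
  by rewrite /geometric /= mul1r -mulNr expRM_natr.
apply: cvg_EFin; first exact: nearW.
have -> : geom d = (1 * (1 - expR (- d))^-1)%R by rewrite mul1r.
apply: cvg_geometric_series.
by rewrite ger0_norm ?expR_ge0// expR_lt1 oppr_lt0.
Qed.

Lemma nneseries_le_geom d b (u : nat -> \bar R) : (0 < d)%R ->
  (forall i, 0 <= u i) -> (forall i, u i <= (b * expR (- (d * i%:R)))%:E) ->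
  \sum_(0 <= i <oo) u i <= (b * geom d)%:E.
Proof.
move=> d0 u0 ub; apply: (@le_trans _ _ (\sum_(0 <= i <oo) b%:E * (expR (- (d * i%:R)))%:E)).
  by apply: lee_nneseries => // i _; rewrite -EFinM.
by rewrite nneseriesZl ?nneseries_expR// => i _; rewrite lee_fin expR_ge0.
Qed.

Lemma sum_expR_le d N : (0 < d)%R ->
  (\sum_(i < N) expR (d * i%:R) <= (expR d - 1)^-1 * expR (d * N%:R))%R.
Proof.
move=> d0; have e1 : (0 < expR d - 1)%R by rewrite subr_gt0 expR_gt1.
elim: N => [|N IH]; first by rewrite big_ord0 mulr_ge0 ?invr_ge0 ?ltW// expR_gt0.
rewrite big_ord_recr/=; apply: (le_trans (lerD IH (lexx _))).
rewrite -natr1 mulrDr mulr1 expRD le_eqVlt; apply/orP; left; apply/eqP.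
by field; rewrite gt_eqF.
Qed.

End geometric_sums.

(** * Weak-type estimate for the potential *)

Section weak_potential.
Context {R : realType} {n : nat}.
Hypothesis n_gt0 : (0 < n)%N.
Implicit Types (g s t a c : R) (x y : Rn R n) (F : Rn R n -> \bar R).
Local Notation mu := (@lebesgue_n R n).

Lemma measurable_superlevel F (y : R) : measurable_fun [set: Rn R n] F ->
  measurable [set x | y%:E < F x].
Proof. by move=> mF; rewrite -[X in measurable X]setTI; exact: emeasurable_fun_o_infty. Qed.

Lemma measurable_patch_superlevel F (y : R) : measurable_fun [set: Rn R n] F ->
  measurable_fun [set: Rn R n] (F \_ [set x | y%:E < F x]).
Proof.
move=> mF; apply/(measurable_restrictT _ _).1; first exact: measurable_superlevel.
exact: measurable_funTS.
Qed.

(** Layer by layer: where [F] lies between the levels of index [i] and [i.+1], it is at most the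
    upper one, [w i]. Since [a < 1], the products of [w i] with the measure bounds form a geometric
    series. *)
Lemma integral_superlevel_le F a s t : measurable_fun [set: Rn R n] F ->
  (forall x, 0 <= F x) -> (0 < a < 1)%R -> (0 < s)%R ->
  (forall i : nat, lebesgue_n [set x | (s * expR (a * i%:R))%:E < F x] <=
     (expR (t - i%:R))%:E) ->
  \int[mu]_x (F \_ [set x | s%:E < F x]) x <=
  (s * expR (a + t) * geom (1 - a))%:E.
Proof.
move=> mF F0 /andP[a0 a1] s0 FE.
pose E (i : nat) := [set x | (s * expR (a * i%:R))%:E < F x].
pose w (i : nat) : \bar R := (s * expR (a * i.+1%:R))%:E.
have w0 i : 0 <= w i by rewrite lee_fin mulr_ge0 ?expR_ge0// ltW.
have mE i : measurable (E i) by exact: measurable_superlevel.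
apply: (@le_trans _ _ (\int[mu]_x (\sum_(i <oo) w i * (\1_(E i) x)%:E))).
  apply: ge0_le_integral_nonmeas => x _; first exact: erestrict_ge0.
  set S := (X in _ <= X).
  have term0 i : 0 <= w i * (\1_(E i) x)%:E by rewrite mule_ge0// lee_fin.
  have S0 : 0 <= S by exact: nneseries_ge0.
  rewrite patchE; case: ifPn => // /set_mem/= sF.
  (* If the step function had a value [S] below [F x], climbing the levels would put [x] in every
     [E i], and the finite [S] would exceed every [w i]. The argument covers [F x = +oo]. *)
  rewrite leNgt; apply/negP => SF.
  have wS i : E i x -> w i <= S.
    move=> Eix; rewrite /S (@nneseriesD1 _ _ i)// indicE mem_set// mule1.
    by rewrite leeDl// nneseries_ge0.
  have Ex i : E i x.
    elim: i => [|i IH]; first by rewrite /E/= mulr0 expR0 mulr1.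
    by rewrite /E/=; exact: le_lt_trans (wS i IH) SF.
  have Sfin : S \is a fin_num.
    by rewrite ge0_fin_numE// (lt_le_trans SF)// leey.
  have sa0 : (0 < s * a)%R by rewrite mulr_gt0.
  have SR0 : (0 <= fine S / (s * a))%R by rewrite divr_ge0 ?fine_ge0// ltW.
  have /andP[_] := truncn_itv SR0; set m := Num.truncn _ => mS.
  have := wS m (Ex m); rewrite -(fineK Sfin) lee_fin leNgt => /negP; apply.
  move: mS; rewrite ltr_pdivrMr// => /lt_le_trans; apply.
  rewrite mulrC -mulrA ler_wpM2l ?(ltW s0)//.
  by apply: le_trans (expR_ge1Dx _); rewrite lerDr.
rewrite integral_step//.
apply: (nneseries_le_geom (1 - a)%R) => [|i|i].
- by rewrite subr_gt0.
- by rewrite mule_ge0.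
apply: (@le_trans _ _ (w i * (expR (t - i%:R))%:E)).
  by rewrite lee_wpmul2l//; exact: FE.
rewrite /w -EFinM lee_fin -!mulrA -!expRD ler_wpM2l ?(ltW s0)// ler_expR -natr1.
by lra.
Qed.

(** Below [s], the layers are peeled off down to the level [w i]; the remainder, at most [w i], is
    integrated over the cube. As [c < 1], the layer integrals grow geometrically, so all of them are
    controlled by the last. *)
Lemma integral_cube_tail_le F c s t (i : nat) x B : measurable_fun [set: Rn R n] F ->
  (forall x, 0 <= F x) -> (c < 1)%R -> (0 < s)%R -> (0 <= B)%R ->
  \int[mu]_x (F \_ [set x | s%:E < F x]) x <= (s * expR t * B)%:E ->
  (forall i : nat, lebesgue_n [set x | (s * expR (- (c * i%:R)))%:E < F x] <=
     (expR (t + i%:R))%:E) ->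
  \int[mu]_(y in centred_cube (t + i%:R) x) F y <=
  (s * expR t * (B + expR 1 * (expR (1 - c) - 1)^-1 + 1) * expR ((1 - c) * i%:R))%:E.
Proof.
move=> mF F0 c1 s0 B0 FB FE.
pose E (l : nat) := [set x | (s * expR (- (c * l%:R)))%:E < F x].
pose w (l : nat) : \bar R := (s * expR (- (c * l%:R)))%:E.
pose F1 := F \_ [set x | s%:E < F x].
set Q := centred_cube _ _.
have w0 l : 0 <= w l by rewrite lee_fin mulr_ge0 ?expR_ge0// ltW.
have mE l : measurable (E l) by exact: measurable_superlevel.
have mQ : measurable Q by exact: measurable_centred_cube.
have F10 y : 0 <= F1 y by exact: erestrict_ge0.
have mF1 : measurable_fun [set: Rn R n] F1 by exact: measurable_patch_superlevel.
have mi A : measurable A -> measurable_fun [set: Rn R n] (fun x => (\1_A x)%:E : \bar R).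
  by move=> mA; apply/measurable_EFinP; exact: measurable_indic.
have mw A l : measurable A -> measurable_fun [set: Rn R n] (fun x => w l * (\1_A x)%:E).
  by move=> mA; apply: measurable_funeM; exact: mi.
have wi0 A l y : 0 <= w l * (\1_A y)%:E by rewrite mule_ge0// lee_fin.
have ptw y : F y <= F1 y + \sum_(l < i) w l * (\1_(E l.+1) y)%:E + w i.
  elim: i {Q mQ} => [|i IH].
    rewrite big_ord0 adde0 /F1 /w mulr0 oppr0 expR0 mulr1 patchE.
    case: ifPn => [_|/negP]; first by rewrite leeDl// lee_fin ltW.
    by rewrite inE /= add0e => /negP; rewrite -leNgt.
  have s0' j : 0 <= F1 y + \sum_(l < j) w l * (\1_(E l.+1) y)%:E.
    by rewrite adde_ge0// sume_ge0.
  have [Ey|Ey] := pselect (E i.+1 y).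
    apply: (le_trans IH); rewrite big_ord_recr/= indicE mem_set// mule1.
    by rewrite addeA leeDl.
  have Fw : F y <= w i.+1 by rewrite leNgt; apply/negP.
  by apply: (le_trans Fw); rewrite leeDr.
apply: (@le_trans _ _ (\int[mu]_y (F1 y + \sum_(l < i) w l * (\1_(E l.+1) y)%:E
                                   + w i * (\1_Q y)%:E))).
  rewrite integral_mkcond; apply: ge0_le_integral_nonmeas => y _; first exact: erestrict_ge0.
  rewrite patchE; case: ifPn => [Qy|_]; first by rewrite indicE Qy mule1.
  by rewrite !adde_ge0// sume_ge0.
have ms : measurable_fun [set: Rn R n] (fun y => \sum_(l < i) w l * (\1_(E l.+1) y)%:E).
  by apply: emeasurable_sum => l; exact: mw.
have mFs : measurable_fun [set: Rn R n]
    (fun y => F1 y + \sum_(l < i) w l * (\1_(E l.+1) y)%:E) by exact: emeasurable_funD.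
have i0 (A : set (Rn R n)) y : 0 <= (\1_A y)%:E :> \bar R by rewrite lee_fin.
have iw A l : measurable A -> \int[mu]_y (w l * (\1_A y)%:E) = w l * mu A.
  move=> mA; rewrite (@ge0_integralZl _ _ _ mu _ measurableT _ (mi A mA) (w l)
    (fun y _ => i0 A y) (w0 l)).
  by rewrite integral_indic// setIT.
have s00 y : 0 <= \sum_(l < i) w l * (\1_(E l.+1) y)%:E by rewrite sume_ge0.
have Fs0 y : 0 <= F1 y + \sum_(l < i) w l * (\1_(E l.+1) y)%:E by rewrite adde_ge0.
rewrite (@ge0_integralD _ _ _ mu _ measurableT _ _ (fun y _ => Fs0 y) mFs
  (fun y _ => wi0 Q i y) (mw Q i mQ)).
rewrite (@ge0_integralD _ _ _ mu _ measurableT _ _ (fun y _ => F10 y) mF1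
  (fun y _ => s00 y) ms).
rewrite (@ge0_integral_sum _ _ _ mu _ measurableT 'I_i (fun l y => w l * (\1_(E l.+1) y)%:E)
  (fun l => mw _ _ (mE l.+1)) (fun l y _ => wi0 _ l y)).
rewrite iw//.
apply: (@le_trans _ _ ((s * expR t * B)%:E +
    \sum_(l < i) (s * expR t * (expR 1 * expR ((1 - c) * l%:R)))%:E +
    (s * expR t * expR ((1 - c) * i%:R))%:E)).
  apply: leeD; first apply: leeD => //.
    apply: lee_sum => l _; rewrite iw//.
    apply: (@le_trans _ _ (w l * (expR (t + l.+1%:R))%:E)).
      by rewrite lee_wpmul2l//; exact: FE.
    rewrite /w -EFinM lee_fin -!mulrA -!expRD ler_wpM2l ?(ltW s0)// ler_expR -natr1.
    by lra.
  rewrite (_ : mu Q = (expR (t + i%:R))%:E); last exact: lebesgue_n_centred_cube.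
  rewrite /w -EFinM lee_fin -!mulrA -!expRD ler_wpM2l ?(ltW s0)// ler_expR.
  by lra.
rewrite sumEFin -!EFinD lee_fin -mulr_sumr -mulr_sumr.
have := sum_expR_le (1 - c)%R i; rewrite subr_gt0 => /(_ c1).
set W := expR ((1 - c) * i%:R); set Sg := (\sum_(l < i) _)%R; set G := (_^-1)%R => SgG.
have W1 : (1 <= W)%R by rewrite -expR0 ler_expR mulr_ge0// subr_ge0 ltW.
have BW : (B <= B * W)%R by rewrite ler_peMr.
have eS : (expR 1 * Sg <= expR 1 * (G * W))%R by rewrite ler_wpM2l ?expR_ge0.
have X0 : (0 <= s * expR t)%R by rewrite mulr_ge0 ?expR_ge0// ltW.
rewrite -!mulrDr -mulrA ler_wpM2l//.
by clear -BW eS; lra.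
Qed.

(** The three terms are the Chebyshev level for the part of [F] above [s] on small cubes, the part
    of [F] at most [s] on small cubes, and the pointwise bound on large cubes, summable because
    [g < c]. *)
Definition weakC g a c : R :=
  (let B := expR a * geom (1 - a) in
   geom g * B + geom g + (B + expR 1 * (expR (1 - c) - 1)^-1 + 1) * geom (c - g))%R.

Lemma measurable_integral_centred_cube s F : measurable_fun [set: Rn R n] F ->
  (forall x, 0 <= F x) ->
  measurable_fun [set: Rn R n] (fun x => \int[mu]_(y in centred_cube s x) F y).
Proof.
move=> mF F0.
pose h (z : Rn R n * Rn R n) :=
  F z.2 * (\1_[set z : Rn R n * Rn R n | centred_cube s z.1 z.2] z)%:E.
have mh : measurable_fun [set: Rn R n * Rn R n] h.
  apply: emeasurable_funM.
    exact: (measurableT_comp mF (@measurable_snd _ _ (Rn R n) (Rn R n))).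
  by apply/measurable_EFinP; apply: measurable_indic; exact: measurable_centred_cube_pair.
have h0 z : 0 <= h z by rewrite mule_ge0// lee_fin.
rewrite (_ : (fun x => _) = (fun x => \int[mu]_y h (x, y))).
  exact: measurable_fun_fubini_tonelli_F.
apply/funext => x; rewrite integral_mkcond; apply: eq_integral => y _.
rewrite patchE /h indicE /=; have [e|e] := pselect (centred_cube s x y).
  by rewrite !mem_set// mule1.
by rewrite !memNset// mule0.
Qed.

Lemma measurable_avg g s F : measurable_fun [set: Rn R n] F -> (forall x, 0 <= F x) ->
  measurable_fun [set: Rn R n] (avg g s F).
Proof. by move=> mF F0; apply: measurable_funeM; exact: measurable_integral_centred_cube. Qed.

End weak_potential.

Section weak_potential_type.
Context {R : realType} {n : nat}.
Hypothesis n_gt0 : (0 < n)%N.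
Implicit Types (g s t a c : R) (x y : Rn R n) (F : Rn R n -> \bar R).
Local Notation mu := (@lebesgue_n R n).

(* The large cubes and the part of F below the level s are bounded pointwise, the rest
   is controlled in L^1. *)
Lemma weak_potential g a c s t F : measurable_fun [set: Rn R n] F ->
  (forall x, 0 <= F x) -> (0 < g < c)%R -> (c < 1)%R -> (0 < a < 1)%R -> (0 < s)%R ->
  (forall i : nat, lebesgue_n [set x | (s * expR (a * i%:R))%:E < F x] <=
     (expR (t - i%:R))%:E) ->
  (forall i : nat, lebesgue_n [set x | (s * expR (- (c * i%:R)))%:E < F x] <=
     (expR (t + i%:R))%:E) ->
  lebesgue_n [set x | (weakC g a c * s * expR (g * t))%:E < potential g t F x] <=
  (expR t)%:E.
Proof.
move=> mF F0 /andP[g0 gc] c1 a01 s0 Fa Fc.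
pose F1 := F \_ [set x | s%:E < F x].
have F10 y : 0 <= F1 y by exact: erestrict_ge0.
have mF1 : measurable_fun [set: Rn R n] F1 by exact: measurable_patch_superlevel.
have a1 : (0 < 1 - a)%R by case/andP: a01 => _; rewrite subr_gt0.
have [B BE] : exists B, B = (expR a * geom (1 - a))%R by eexists.
have B0 : (0 < B)%R by rewrite BE mulr_gt0 ?expR_gt0 ?geom_gt0.
have FB : \int[mu]_x F1 x <= (s * expR t * B)%:E.
  have := integral_superlevel_le F a s t mF F0 a01 s0 Fa.
  by rewrite (_ : s * expR (a + t) * geom (1 - a) = s * expR t * B)%R// expRD BE; ring.
pose K2 := (B + expR 1 * (expR (1 - c) - 1)^-1 + 1)%R.
have e1c : (0 < expR (1 - c) - 1)%R by rewrite subr_gt0 expR_gt1 subr_gt0.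
have K20 : (0 <= K2)%R.
  by rewrite /K2 !addr_ge0// ?(ltW B0)// mulr_ge0 ?expR_ge0// invr_ge0 ltW.
have sg0 : (0 < s * expR (g * t))%R by rewrite mulr_gt0 ?expR_gt0.
(* The factor [expR ((g - 1) * _)] of the average meets the growth [expR ((1 - c) * _)] of the
   integrals; the product decays at rate [c - g]. *)
have large x : \sum_(0 <= i <oo) avg g (t + i.+1%:R) F x <=
    (s * expR (g * t) * K2 * geom (c - g))%:E.
  apply: (nneseries_le_geom (c - g)%R) => [|i|i].
  - by rewrite subr_gt0.
  - exact: avg_ge0.
  apply: (@le_trans _ _ ((expR ((g - 1) * (t + i.+1%:R)))%:E *
     (s * expR t * K2 * expR ((1 - c) * i.+1%:R))%:E)).
    rewrite lee_wpmul2l ?lee_fin ?expR_ge0//.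
    exact: (integral_cube_tail_le n_gt0 F c s t i.+1 x B mF F0 c1 s0 (ltW B0) FB Fc).
  have -> : (expR ((g - 1) * (t + i.+1%:R)))%:E *
     (s * expR t * K2 * expR ((1 - c) * i.+1%:R))%:E =
     (s * K2 * expR ((g - 1) * (t + i.+1%:R) + t + (1 - c) * i.+1%:R))%:E.
    by rewrite -EFinM !expRD; congr (_%:E); ring.
  rewrite lee_fin (_ : _ * _ * K2 * _ = s * K2 * expR (g * t - (c - g) * i%:R))%R; last first.
    by rewrite expRD; ring.
  rewrite ler_wpM2l ?mulr_ge0 ?(ltW s0)// ler_expR -natr1.
  by clear - gc; lra.
pose H x := \sum_(0 <= i <oo) avg g (t - i%:R) F1 x.
(* With [F] at most [F1 + s], the constant [s] contributes [s] times e^(g(t - i)) on the cube of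
   volume e^(t - i). *)
have small x : \sum_(0 <= i <oo) avg g (t - i%:R) F x <=
    H x + (s * expR (g * t) * geom g)%:E.
  apply: (@le_trans _ _ (\sum_(0 <= i <oo)
      (avg g (t - i%:R) F1 x + (s * expR (g * t) * expR (- (g * i%:R)))%:E))).
    apply: lee_nneseries => [i _ _|i _]; first exact: avg_ge0.
    have mc := measurable_centred_cube (t - i%:R) x.
    apply: (@le_trans _ _ (avg g (t - i%:R) (fun y => F1 y + s%:E) x)).
      apply: le_avg => // y; rewrite /F1 patchE.
      case: ifPn => [_|/negP]; first by rewrite leeDl// lee_fin ltW.
      by rewrite inE /= add0e => /negP; rewrite -leNgt.
    rewrite /avg ge0_integralD//; last 2 first.
    - exact: measurable_funTS.
    - by move=> y _; rewrite lee_fin ltW.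
    rewrite ge0_muleDr//; last 2 first.
    - exact: integral_ge0.
    - by apply: integral_ge0 => y _; rewrite lee_fin ltW.
    rewrite leeD2l// (@integral_cst _ _ _ mu _ mc) [X in s%:E * X](_ : _ = (expR (t - i%:R))%:E).
      rewrite -!EFinM lee_fin mulrCA -mulrA ler_wpM2l ?(ltW s0)// -!expRD ler_expR.
      by lra.
    exact: lebesgue_n_centred_cube.
  rewrite nneseriesD; last 2 first.
  - by move=> i _ _; exact: avg_ge0.
  - by move=> i _ _; rewrite lee_fin mulr_ge0 ?expR_ge0// ltW.
  rewrite leeD2l//; apply: (nneseries_le_geom g) => // i.
  by rewrite lee_fin mulr_ge0 ?expR_ge0// ltW.
have mavg i : measurable_fun [set: Rn R n] (avg g (t - i%:R) F1) by exact: measurable_avg.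
have H0 x : 0 <= H x by apply: nneseries_ge0 => i _ _; exact: avg_ge0.
(* Averaging over cubes of volume e^(t - i) multiplies the L^1 norm by e^(g(t - i)), summable in [i]
   because [g > 0]. *)
have intH : \int[mu]_x H x <= (s * expR (g * t) * geom g * B)%:E * (expR t)%:E.
  rewrite integral_nneseries//; last by move=> i x _; exact: avg_ge0.
  apply: (@le_trans _ _ ((s * expR (g * t) * B * expR t * geom g)%:E)).
    apply: (nneseries_le_geom g) => // [i|i].
      by apply: integral_ge0 => x _; exact: avg_ge0.
    have mI := measurable_integral_centred_cube (t - i%:R) F1 mF1 F10.
    rewrite (@ge0_integralZl _ _ _ mu _ measurableT _ mI); last 2 first.
    - by move=> x _; exact: integral_ge0.
    - by rewrite lee_fin expR_ge0.
    rewrite integral_centred_cube// muleA -EFinM -expRD.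
    apply: (@le_trans _ _ ((expR ((g - 1) * (t - i%:R) + (t - i%:R)))%:E * (s * expR t * B)%:E)).
      by rewrite lee_wpmul2l ?lee_fin ?expR_ge0.
    rewrite -EFinM lee_fin (_ : _ * B * _ * _ = expR (g * t - g * i%:R) * (s * expR t * B))%R.
      rewrite ler_wpM2r ?mulr_ge0 ?expR_ge0 ?(ltW s0) ?(ltW B0)// ler_expR.
      by lra.
    by rewrite expRD; ring.
  by rewrite -EFinM lee_fin le_eqVlt; apply/orP; left; apply/eqP; ring.
(* The level at which Chebyshev's inequality turns the bound on the integral of [H] into the measure
   e^t. *)
pose Y := (s * expR (g * t) * geom g * B)%R.
have Y0 : (0 < Y)%R by rewrite !mulr_gt0 ?expR_gt0 ?geom_gt0.
apply: (@le_trans _ _ (lebesgue_n [set x | Y%:E < H x])).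
  apply: le_lebesgue_n => x /=; rewrite !ltNge; apply: contra => HY.
  apply: (@le_trans _ _ ((Y%:E + (s * expR (g * t) * geom g)%:E) +
      (s * expR (g * t) * K2 * geom (c - g))%:E)).
    by apply: leeD => //; apply: (le_trans (small x)); exact: leeD.
  rewrite -!EFinD lee_fin le_eqVlt; apply/orP; left; apply/eqP.
  by rewrite /weakC -BE /Y /K2; ring.
have mH : measurable_fun [set: Rn R n] H 
  by apply: ge0_emeasurable_sum => // i x _ _; exact: avg_ge0.
have mA : measurable [set x | Y%:E < H x] by exact: measurable_superlevel.
rewrite -(@lee_pmul2l _ Y%:E) ?lte_fin//.
apply: le_trans intH; rewrite -(integral_cst mu mA) integral_mkcond.
apply: ge0_le_integral_nonmeas => x _.
  by apply: erestrict_ge0 => y _; rewrite lee_fin ltW.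
by rewrite patchE; case: ifPn => // /set_mem/= /ltW.
Qed.

End weak_potential_type.

(** * Modulars of nonincreasing functions *)

Section sums_over_int.
Context {R : realType}.
Implicit Types (a b : int -> \bar R).

(** Lists the integers as 0, -1, 1, -2, 2, ... *)
Definition zenum (i : nat) : int := if odd i then Negz i./2 else Posz i./2.

Definition zindex (k : int) : nat := match k with Posz m => m.*2 | Negz m => m.*2.+1 end.

Lemma zindexK : cancel zindex zenum.
Proof.
by case=> m; rewrite /zenum /= odd_double/= ?doubleK// uphalf_double.
Qed.

Lemma zenumK : cancel zenum zindex.
Proof.
move=> i; rewrite /zenum -[RHS]odd_double_half; case: ifP => _ //=.
Qed.

Definition isum a : \bar R := \sum_(0 <= i <oo) a (zenum i).

Lemma isum_ge0 a : (forall k, 0 <= a k) -> 0 <= isum a.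
Proof. by move=> a0; apply: nneseries_ge0. Qed.

Lemma le_isum a b : (forall k, 0 <= a k) -> (forall k, a k <= b k) -> isum a <= isum b.
Proof. by move=> a0 ab; apply: lee_nneseries. Qed.

Lemma isumD a b : (forall k, 0 <= a k) -> (forall k, 0 <= b k) ->
  isum (fun k => a k + b k) = isum a + isum b.
Proof. by move=> a0 b0; apply: nneseriesD. Qed.

Lemma isumZl (r : R) a : (forall k, 0 <= a k) -> isum (fun k => r%:E * a k) = r%:E * isum a.
Proof. by move=> a0; apply: nneseriesZl. Qed.

Lemma term_le_isum a k : (forall k, 0 <= a k) -> a k <= isum a.
Proof.
move=> a0; rewrite /isum (@nneseriesD1 _ _ (zindex k))// zindexK.
by rewrite leeDl// nneseries_ge0.
Qed.

Lemma isum_interchange (a : int -> int -> \bar R) : (forall k j, 0 <= a k j) ->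
  isum (fun k => isum (a k)) = isum (fun j => isum (a ^~ j)).
Proof. by move=> a0; exact: (@nneseries_interchange R (fun i j => a (zenum i) (zenum j)) xpredT xpredT). Qed.

(** A shift permutes the enumeration, so the series is read as an unordered sum, which is invariant
    under bijections. *)
Lemma isum_shift a j : (forall k, 0 <= a k) -> isum (fun k => a (k - j)%R) = isum a.
Proof.
move=> a0; rewrite /isum !nneseries_esumT//.
rewrite [RHS](reindex_esum [set: nat] [set: nat] (fun i => zindex (zenum i - j)%R)).
  by apply: eq_esum => i _; rewrite zindexK.
split=> //.
  move=> i1 i2 _ _ /(congr1 zenum); rewrite !zindexK => /addIr.
  exact: (can_inj zenumK).
move=> i _; exists (zindex (zenum i + j)%R) => //=.
by rewrite zindexK addrK zenumK.
Qed.

(** The rate is halved because the [i]-th listed integer has absolute value at least [i / 2]. *)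
Lemma isum_expR (d : R) : (0 < d)%R ->
  isum (fun k => (expR (- (d * `|k|%N%:R)))%:E) <= (geom (d / 2))%:E.
Proof.
move=> d0; rewrite -[geom _]mul1r; apply: (nneseries_le_geom (d / 2)%R) => [|i|i].
- by rewrite divr_gt0.
- by rewrite lee_fin expR_ge0.
rewrite lee_fin mul1r ler_expR lerN2 -mulrA ler_wpM2l ?(ltW d0)//.
rewrite ler_pdivrMl// -natrM ler_nat mul2n /zenum.
case: ifPn => oi; rewrite /= -{1}[i]odd_double_half ?oi ?(negbTE oi)//.
Qed.

End sums_over_int.

(** * Exponential shells of the half-line *)

Section dyadic_intervals.
Context {R : realType}.
Implicit Types (k : int) (f : R -> \bar R).

Definition shell k : set (R1 R) := [set t : R | (expR (k%:~R - 1) < t <= expR k%:~R)%R].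

Lemma measurable_shell k : measurable (shell k).
Proof.
apply: (@sub_caratheodory _ _ _ (wlength idfun)).
rewrite (_ : shell k = `](expR (k%:~R - 1)), (expR k%:~R)]%classic); last first.
  by apply/seteqP; split=> t /=; rewrite in_itv.
exact: (@measurable_itv R `](expR (k%:~R - 1)), (expR k%:~R)]).
Qed.

Lemma lebesgue_1_shell k :
  lebesgue_1 R (shell k) = (expR k%:~R * (1 - expR (-1)))%:E.
Proof.
transitivity (@lebesgue_measure R `](expR (k%:~R - 1)), (expR k%:~R)]%classic).
  congr (mu_ext _ _); apply/seteqP; split=> t /=; rewrite in_itv//.
rewrite lebesgue_measure_itv/= lte_fin ltr_expR ifT ?ltrBlDr ?ltrDl//.
by rewrite -EFinB mulrBr mulr1 expRD.
Qed.

Lemma shellP k (t : R) : shell k t -> (0 < t)%R /\ (k%:~R - 1 < ln t <= k%:~R)%R.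
Proof.
move=> /= /andP[kt tk]; have t0 : (0 < t)%R by apply: lt_trans kt; exact: expR_gt0.
by split=> //; rewrite -ltr_expR -ler_expR lnK ?posrE// kt tk.
Qed.

Lemma shell_ceil (t : R) : (0 < t)%R -> shell (Num.ceil (ln t)) t.
Proof.
move=> t0; have := ceil_itv (ln t); rewrite intrD mulrN1z.
by rewrite -ltr_expR -ler_expR lnK ?posrE.
Qed.

Lemma trivIset_shell : trivIset [set: nat] (shell \o zenum).
Proof.
move=> i j _ _ [t [/shellP[_ ti] /shellP[_ tj]]].
have ceilE k : (k%:~R - 1 < ln t <= k%:~R)%R -> Num.ceil (ln t) = k.
  by move=> h; apply: ceil_def; rewrite intrD mulrN1z.
by apply: (can_inj zenumK); rewrite -(ceilE _ ti) -(ceilE _ tj).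
Qed.

(** The factor [expR (- k)] cancels the length of the shell up to [1 - expR (-1)], so [c k] measures
    the mass carried by shell [k]. *)
Lemma isum_shell_le_integral f (c : int -> \bar R) :
  (forall t, (0 < t)%R -> 0 <= f t) -> (forall k, 0 <= c k) ->
  {ae lebesgue_1 R, forall t, forall k, shell k t -> (expR (- k%:~R))%:E * c k <= f t} ->
  (1 - expR (-1))%:E * isum c <= \int[lebesgue_1 R]_(t in `]0%R, +oo[%classic) f t.
Proof.
move=> f0 c0 cf.
rewrite -isumZl//.
rewrite (_ : isum _ = \sum_(i <oo) ((expR (- (zenum i)%:~R))%:E * c (zenum i)) *
   lebesgue_1 R (shell (zenum i))); last first.
  apply: eq_eseriesr => i _; rewrite lebesgue_1_shell muleAC -EFinM mulrA.
  by rewrite -expRD addNr expR0 mul1r.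
apply: (step_le_integral _ _ _ _ _ _ (fun i => (expR (- (zenum i)%:~R))%:E * c (zenum i))
  (shell \o zenum)).
- by move=> t; rewrite /= in_itv/= andbT; exact: f0.
- by move=> i; rewrite mule_ge0// lee_fin expR_ge0.
- by move=> i; exact: measurable_shell.
- exact: trivIset_shell.
- by move=> i t /shellP[t0 _]; rewrite /= in_itv/= andbT.
- by apply: filterS cf => t h i; exact: h.
Qed.

Lemma integral_le_isum_shell f (c : int -> \bar R) :
  (forall t, (0 < t)%R -> 0 <= f t) -> (forall k, 0 <= c k) ->
  {ae lebesgue_1 R, forall t, forall k, shell k t -> f t <= (expR (- k%:~R))%:E * c k} ->
  \int[lebesgue_1 R]_(t in `]0%R, +oo[%classic) f t <= isum c.
Proof.
move=> f0 c0 cf.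
have c0' k : 0 <= (expR (- k%:~R))%:E * c k by rewrite mule_ge0// lee_fin expR_ge0.
apply: (@le_trans _ _ (\sum_(i <oo) ((expR (- (zenum i)%:~R))%:E * c (zenum i)) *
   lebesgue_1 R (shell (zenum i)))); last first.
  apply: lee_nneseries => [i _ _|i _]; first by rewrite mule_ge0.
  rewrite lebesgue_1_shell muleAC -EFinM mulrA -expRD addNr expR0 mul1r.
  by rewrite gee_pMl// lee_fin gerBl expR_ge0.
apply: (integral_le_step _ _ _ _ _ _ (fun i => (expR (- (zenum i)%:~R))%:E * c (zenum i))
  (shell \o zenum)).
- by move=> t; rewrite /= in_itv/= andbT; exact: f0.
- by move=> i.
- by move=> i; exact: measurable_shell.
- move=> t; rewrite /= in_itv/= andbT => t0; exists (zindex (Num.ceil (ln t))) => //=.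
  by rewrite zindexK; exact: shell_ceil.
- by apply: filterS cf => t h i; exact: h.
Qed.

End dyadic_intervals.

Lemma ae_imply2 d (T : measurableType d) (R : realType) (mu : {measure set T -> \bar R})
    (P Q S : T -> Prop) : {ae mu, forall x, P x} -> {ae mu, forall x, Q x} ->
  (forall x, P x -> Q x -> S x) -> {ae mu, forall x, S x}.
Proof. by move=> aeP aeQ PQS; apply: filterS2 aeP aeQ. Qed.

(** * Freezing log-Hoelder exponents *)

Section log_holder.
Context {R : realType}.
Implicit Types (e : R -> R) (k : int).

Lemma powR_perturb (lo K C x u w : R) (k : nat) : (0 < lo)%R -> (1 <= K)%R ->
  (0 <= C)%R -> (0 <= x <= K)%R -> (lo <= u)%R -> (lo <= w)%R ->
  (`|u - w| <= C / (1 + k%:R))%R ->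
  (x `^ u <= expR (C * (ln K + lo^-1)) * x `^ w + expR (- k%:R))%R.
Proof.
move=> lo0 K1 C0 /andP[x0 xK] lou low uw.
have u0 : (0 < u)%R by exact: lt_le_trans lou.
have [->|xN0] := eqVneq x 0%R.
  by rewrite powR0 ?gt_eqF// addr_ge0 ?mulr_ge0 ?expR_ge0// powR_ge0.
have {}x0 : (0 < x)%R by rewrite lt_neqAle eq_sym xN0.
have [z zx] : exists z, x = expR z by exists (ln x); rewrite lnK.
have lnK0 : (0 <= ln K)%R by rewrite ln_ge0.
have zK : (z <= ln K)%R by rewrite -[z]expRK -zx ler_ln ?posrE// (lt_le_trans _ K1).
rewrite zx -!expRM -expRD.
have [zu|zu] := leP (z * u)%R (- k%:R)%R.
  by rewrite -[leLHS]add0r lerD ?expR_ge0// ler_expR.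
rewrite -[leLHS]addr0 lerD ?expR_ge0// ler_expR.
have -> : (z * u = (u - w) * z + z * w)%R by ring.
rewrite lerD2r (le_trans (ler_norm _))// normrM.
have k0 : (0 <= k%:R :> R)%R by [].
have zabs : (`|z| <= ln K + k%:R / lo)%R.
  have kl : (0 <= k%:R / lo)%R by rewrite divr_ge0// ltW.
  have [z0|z0] := leP 0%R z; first by rewrite ger0_norm//; lra.
  rewrite ltr0_norm// -[leLHS]add0r lerD// ler_pdivlMr//.
  apply: le_trans (_ : - z * u <= _)%R; first by rewrite ler_wpM2l// oppr_ge0 ltW.
  by rewrite mulNr lerNl ltW.
apply: le_trans (ler_pM _ _ uw zabs) _ => //.
rewrite -mulrA ler_wpM2l// mulrC ler_pdivrMr ?ltr_pwDl//.
have li : (0 <= lo^-1)%R by rewrite invr_ge0 ltW.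
rewrite mulrDr mulr1 !mulrDl (mulrC (lo^-1)%R).
have : (0 <= ln K * k%:R)%R by rewrite mulr_ge0.
by lra.
Qed.

(* The values of the exponent at 0 and at infinity. *)
Definition side (e0 e1 : R) k := if (k <= 0)%R then e0 else e1.

Lemma side_itv (e0 e1 lo hi : R) k : (lo <= e0 <= hi)%R -> (lo <= e1 <= hi)%R ->
  (lo <= side e0 e1 k <= hi)%R.
Proof. by rewrite /side; case: ifP. Qed.

(* Both log-Hoelder conditions at once, on the scale ln t: near 0 and near infinity,
   |ln t - k| <= 1 makes -log t, respectively log(e + t), comparable to 1 + |k|. *)
Definition log_holder e (e0 e1 lo hi C : R) : Prop :=
  [/\ (0 <= C)%R, (lo <= e0 <= hi)%R, (lo <= e1 <= hi)%R &
    {ae lebesgue_1 R, forall t, (0 < t)%R ->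
      (lo <= e t <= hi)%R /\
      forall k, (`|ln t - k%:~R| <= 1)%R -> (`|e t - side e0 e1 k| <= C / (1 + `|k|%N%:R))%R}].

Lemma intr_norm k : (`|k%:~R| = `|k|%N%:R :> R)%R.
Proof. by rewrite -intr_norm -abszE. Qed.

(** When [e0] and [e1] are the limits of a reciprocal exponent 1/p, [expR (phase e0 e1 k)] replaces
    t^(1/p(t)) on the shells next to e^k. *)
Definition phase (e0 e1 : R) k : R := (k%:~R * side e0 e1 k)%R.

(** The decay [C / (1 + |k|)] exactly offsets the factor [k] in front of the error of the
    exponent. *)
Lemma phase_dist (e0 e1 C y z : R) k : (0 <= C)%R -> (0 <= z <= 1)%R ->
  (`|y - k%:~R| <= 1)%R ->
  (`|z - side e0 e1 k| <= C / (1 + `|k|%N%:R))%R ->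
  (`|y * z - phase e0 e1 k| <= C + 1)%R.
Proof.
move=> C0 /andP[z0 z1] yk zk; rewrite /phase.
have -> : (y * z - k%:~R * side e0 e1 k = k%:~R * (z - side e0 e1 k) + (y - k%:~R) * z)%R by ring.
apply: (le_trans (ler_normD _ _)); rewrite !normrM intr_norm lerD//.
  apply: (le_trans (ler_wpM2l _ zk)) => //.
  rewrite mulrCA ler_piMr// ler_pdivrMr ?ltr_pwDl// mul1r.
  by rewrite lerDr.
by rewrite -[leRHS]mulr1 ler_pM// ger0_norm.
Qed.

(** Each unit step has slope [e0] or [e1], even across the change of side, since the phase vanishes
    at [k = 0]. *)
Lemma phase_mono (e0 e1 lo hi : R) k (i : nat) : (lo <= e0 <= hi)%R -> (lo <= e1 <= hi)%R ->
  (lo * i%:R <= phase e0 e1 (k + i%:Z) - phase e0 e1 k <= hi * i%:R)%R.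
Proof.
move=> h0 h1; rewrite /phase; elim: i => [|i /andP[IH1 IH2]].
  by rewrite addr0 subrr !mulr0 lexx.
have step : (lo <= (k + i.+1%:Z)%:~R * side e0 e1 (k + i.+1%:Z) -
    (k + i%:Z)%:~R * side e0 e1 (k + i%:Z) <= hi)%R.
  have -> : (k + i.+1%:Z = (k + i%:Z) + 1)%R by lia.
  move: (k + i%:Z)%R => j; rewrite intrD /side.
  have [j0|j0] := leP j 0%R.
    have [j1|j1] := leP (j + 1)%R 0%R.
      by rewrite mulrDl mul1r addrAC subrr add0r.
    have -> : j = 0%R by lia.
    by rewrite mul0r subr0 add0r mul1r.
  have -> : (j + 1 <= 0)%R = false by lia.
  by rewrite mulrDl mul1r addrAC subrr add0r.
move: step => /andP[s1 s2].
by rewrite -natr1 !mulrDr !mulr1; apply/andP; split; lra.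
Qed.

End log_holder.

(** * Sequences extracted from a bounded modular *)

Section source.
Context {R : realType}.
Variables (eP Q : R -> R) (k0 k1 m M C1 w0 w1 lo hi C2 : R).
Hypothesis m0 : (0 < m)%R.
Hypothesis M1 : (M <= 1)%R.
Hypothesis lo0 : (0 < lo)%R.
Hypothesis heP : log_holder eP k0 k1 m M C1.
Hypothesis hQ : log_holder Q w0 w1 lo hi C2.
Local Notation phi := (phase k0 k1).
Local Notation w := (side w0 w1).

(** The Lorentz integrand with [a] the reciprocal of the first exponent and [b] the second
    exponent. *)
Definition modular_integrand (a : R -> R) (b : R -> R) (g : R -> \bar R) (t : R) : \bar R :=
  (t `^ (b t * a t - 1))%:E * g t `^ b t.

(** On a shell, [g] is at least its value at the right endpoint, and the loss [C1 + 1] covers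
    freezing the phase. A real minorant [y] is used because [g] may be +oo. *)
Lemma modular_lower (g : R -> \bar R) (y : int -> R) :
  (forall t, 0 <= g t) -> (forall s t : R, (0 < s)%R -> (s <= t)%R -> g t <= g s) ->
  (forall k, 0 <= y k)%R ->
  (forall k, (y k)%:E <= (expR (phi k - (C1 + 1)))%:E * g (expR k%:~R)) ->
  {ae lebesgue_1 R, forall t k, shell k t ->
    (expR (- k%:~R))%:E * ((y k) `^ (Q t))%:E <= modular_integrand eP Q g t}.
Proof.
move=> g0 gni y0 yg.
have [C10 _ _ ae1] := heP; have [_ _ _ ae2] := hQ.
apply: (ae_imply2 _ _ _ _ _ _ _ ae1 ae2) => t h1 h2 k kt.
have [t0 /andP[kt1 kt2]] := shellP _ _ kt.
have [/andP[e1 e2] e3] := h1 t0; have [/andP[q1 q2] q3] := h2 t0.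
have tk1 : (`|ln t - k%:~R| <= 1)%R by rewrite ler_norml; apply/andP; split; lra.
have z01 : (0 <= eP t <= 1)%R.
  by rewrite (le_trans (ltW m0) e1)/=; exact: le_trans M1.
have := phase_dist k0 k1 C1 (ln t) (eP t) k C10 z01 tk1 (e3 k tk1).
rewrite ler_norml => /andP[d1 d2].
have Qt0 : (0 <= Q t)%R by apply: le_trans q1; exact: ltW.
rewrite /modular_integrand.
have -> : (t `^ (Q t * eP t - 1) = expR (- ln t) * expR (ln t * eP t * Q t))%R.
  by rewrite -expRD /powR gt_eqF//; congr expR; ring.
rewrite EFinM -muleA; apply: lee_pmul.
- by rewrite lee_fin expR_ge0.
- by rewrite lee_fin powR_ge0.
- by rewrite lee_fin ler_expR lerN2.
rewrite expRM -2!poweR_EFin -poweRM//.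
apply: le_poweR => //; first by rewrite lee_fin.
apply: (le_trans (yg k)); apply: lee_pmul => //.
  by rewrite lee_fin ler_expR; lra.
by apply: gni => //; move: kt => /andP[].
Qed.

Definition massC : R := ((1 - expR (-1))^-1)%R.

Lemma massC_gt0 : (0 < 1 - expR (-1) :> R)%R.
Proof. by rewrite subr_gt0 expR_lt1 oppr_lt0. Qed.

Lemma massC_ge1 : (1 <= massC)%R.
Proof. by rewrite /massC invf_ge1 ?massC_gt0// gerBl expR_ge0. Qed.

Definition sourceK : R := (massC `^ lo^-1)%R.

Lemma sourceK_ge1 : (1 <= sourceK)%R.
Proof. by rewrite -[X in (X <= _)%R](powRr0 massC) ler_powR ?massC_ge1// invr_ge0 ltW. Qed.

Lemma source_bound (g : R -> \bar R) (y : int -> R) :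
  (forall t, 0 <= g t) -> (forall s t : R, (0 < s)%R -> (s <= t)%R -> g t <= g s) ->
  (forall k, 0 <= y k)%R ->
  (forall k, (y k)%:E <= (expR (phi k - (C1 + 1)))%:E * g (expR k%:~R)) ->
  \int[lebesgue_1 R]_(t in `]0%R, +oo[%classic) modular_integrand eP Q g t <= 1 ->
  forall k, (y k <= sourceK)%R.
Proof.
move=> g0 gni y0 yg mod1 k.
have [yk1|yk1] := leP (y k) 1%R; first exact: le_trans yk1 sourceK_ge1.
pose c (j : int) : \bar R := if (1 <= y j)%R then (y j `^ lo)%:E else 0.
have c0 j : 0 <= c j by rewrite /c; case: ifP; rewrite ?lee_fin ?powR_ge0.
have ci : (1 - expR (-1))%:E * isum c <= 1.
  apply: le_trans mod1; apply: isum_shell_le_integral => //.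
    by move=> t _; rewrite mule_ge0 ?poweR_ge0// lee_fin powR_ge0.
  have [_ _ _ ae2] := hQ.
  apply: (ae_imply2 _ _ _ _ _ _ _ ae2 (modular_lower g y g0 gni y0 yg)) => t h2 h j jt.
  apply: le_trans (h j jt); rewrite lee_wpmul2l ?lee_fin ?expR_ge0// /c.
  have [t0 _] := shellP _ _ jt; have [/andP[q1 _] _] := h2 t0.
  by case: ifP => yj1; rewrite lee_fin ?powR_ge0// ler_powR.
have ck : c k <= massC%:E.
  apply: le_trans (term_le_isum _ _ c0) _.
  by rewrite /massC -[leRHS]mul1e lee_pdivlMr ?massC_gt0// muleC.
move: ck; rewrite /c (ltW yk1) lee_fin /sourceK => h.
rewrite -[leLHS]powRr1// -(@mulfV _ lo) ?gt_eqF// powRrM.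
by apply: ge0_ler_powR; rewrite ?nnegrE ?powR_ge0 ?invr_ge0 ?(ltW lo0)// (le_trans ler01 massC_ge1).
Qed.

End source.

Lemma isum_expR1 {R : realType} :
  isum (fun k => (expR (- `|k|%N%:R : R))%:E) <= (geom (1 / 2) : R)%:E.
Proof.
apply: le_trans (isum_expR 1 ltr01); apply: le_isum => k; first by rewrite lee_fin expR_ge0.
by rewrite mul1r.
Qed.

(** * Summability and geometric smoothing *)

Section decay.
Context {R : realType}.
Variables (Q : R -> R) (w0 w1 lo hi C2 : R).
Hypothesis lo0 : (0 < lo)%R.
Hypothesis hQ : log_holder Q w0 w1 lo hi C2.
Local Notation w := (side w0 w1).
Local Notation sourceK := (@sourceK R lo).
Local Notation massC := (@massC R).

Let wlo k : (lo <= w k)%R.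
Proof. by case: hQ => _ a b _; case/andP: (side_itv _ _ _ _ k a b). Qed.

Let whi k : (w k <= hi)%R.
Proof. by case: hQ => _ a b _; case/andP: (side_itv _ _ _ _ k a b). Qed.

Let w_gt0 k : (0 < w k)%R. Proof. exact: lt_le_trans (wlo k). Qed.

Definition smoothC (d A : R) : R :=
  (geom (1 / 2) + (geom (d / 2) * A + sourceK `^ hi * geom (d / 2) * geom (d / 2)))%R.

(** The inner powers carry the exponent of [k], not of [j]. On the same side the two agree and the
    sum is a convolution with a summable kernel. On opposite sides |k - j| = |k| + |j|, and the
    uniform bound on [x] leaves a product of two convergent series. *)
Lemma smooth_decay (d A : R) (x : int -> R) : (0 < d)%R ->
  (forall k, 0 <= x k <= sourceK)%R -> isum (fun k => (x k `^ w k)%:E) <= A%:E ->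
  isum (fun k => (expR (- `|k|%N%:R))%:E +
    isum (fun j => (expR (- (d * `|k - j|%N%:R)) * x j `^ w k)%:E)) <= (smoothC d A)%:E.
Proof.
move=> d0 xK xA.
pose th (k : int) : \bar R := (expR (- (d * `|k|%N%:R)))%:E.
have th0 k : 0 <= th k by rewrite lee_fin expR_ge0.
have thW : isum th <= (geom (d / 2))%:E by exact: isum_expR.
have gd0 : (0 <= geom (d / 2))%R by rewrite ltW// geom_gt0// divr_gt0.
have K1 : (1 <= sourceK)%R by exact: sourceK_ge1.
have e0 k : 0 <= (expR (- `|k|%N%:R : R))%:E by rewrite lee_fin expR_ge0.
have tx0 k j : 0 <= (expR (- (d * `|k - j|%N%:R)) * x j `^ w k)%:E.
  by rewrite lee_fin mulr_ge0 ?expR_ge0 ?powR_ge0.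
rewrite isumD//; last by move=> k; exact: isum_ge0.
rewrite EFinD; apply: leeD; first exact: isum_expR1.
pose y j : \bar R := (x j `^ w j)%:E.
have y0 j : 0 <= y j by rewrite lee_fin powR_ge0.
pose KK : \bar R := (sourceK `^ hi)%:E.
have KK0 : 0 <= KK by rewrite lee_fin powR_ge0.
have dom k j : (expR (- (d * `|k - j|%N%:R)) * x j `^ w k)%:E <=
    th (k - j)%R * y j + KK * th k * th j.
  have [sk|sk] := eqVneq (k <= 0)%R (j <= 0)%R.
    rewrite {1}/side sk -/(w j) EFinM -/(th (k - j)%R) leeDl//.
    by rewrite !mule_ge0.
  have -> : (`|k - j|%N = `|k|%N + `|j|%N)%N by lia.
  apply: (@le_trans _ _ (KK * th k * th j)); last by rewrite leeDr// mule_ge0.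
  rewrite /KK /th -!EFinM lee_fin natrD mulrDr opprD expRD mulrC -!mulrA.
  rewrite ler_wpM2r ?mulr_ge0 ?expR_ge0//.
  have /andP[xj0 xjK] := xK j.
  apply: (@le_trans _ _ (sourceK `^ w k)%R).
    apply: ge0_ler_powR; rewrite ?nnegrE ?(ltW (w_gt0 k))//.
    exact: le_trans xjK.
  by rewrite ler_powR.
have thy0 k j : 0 <= th (k - j)%R * y j by rewrite mule_ge0.
have kth0 k j : 0 <= KK * th k * th j by rewrite !mule_ge0.
apply: (@le_trans _ _ (isum (fun k => isum (fun j => th (k - j)%R * y j + KK * th k * th j)))).
  apply: le_isum => k; first exact: isum_ge0.
  by apply: le_isum.
have -> : isum (fun k => isum (fun j => th (k - j)%R * y j + KK * th k * th j)) =
    isum (fun k => isum (fun j => th (k - j)%R * y j)) +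
    isum (fun k => isum (fun j => KK * th k * th j)).
  rewrite -isumD; [|by move=> k; exact: isum_ge0|by move=> k; exact: isum_ge0].
  by congr isum; apply/funext => k; rewrite isumD.
rewrite EFinD; apply: leeD.
  rewrite isum_interchange//.
  have -> : (fun j => isum (fun k => th (k - j)%R * y j)) = (fun j => isum th * y j).
    apply/funext => j; rewrite muleC -[in RHS](isum_shift th j)//.
    rewrite /y -isumZl; last by move=> k; exact: th0.
    by congr isum; apply/funext => k; rewrite muleC.
  apply: (@le_trans _ _ (isum (fun j => (geom (d / 2))%:E * y j))).
    by apply: le_isum => j; [rewrite mule_ge0// isum_ge0|exact: lee_wpmul2r].
  by rewrite isumZl// EFinM lee_wpmul2l.
have -> : (fun k => isum (fun j => KK * th k * th j)) = (fun k => KK * th k * isum th).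
  by apply/funext => k; rewrite /KK /th -EFinM -isumZl.
apply: (@le_trans _ _ (isum (fun k => (sourceK `^ hi * geom (d / 2))%:E * th k))).
  apply: le_isum => k; first by rewrite !mule_ge0// isum_ge0.
  rewrite EFinM -/KK -!muleA; apply: lee_wpmul2l => //.
  by rewrite muleC; apply: lee_wpmul2r.
rewrite isumZl//.
have KG : (0 <= sourceK `^ hi * geom (d / 2))%R by rewrite mulr_ge0 ?powR_ge0.
by rewrite [leRHS]EFinM lee_wpmul2l.
Qed.

Definition decayC : R :=
  (expR (C2 * (ln sourceK + lo^-1)) * massC + geom (1 / 2))%R.

Variables (eP : R -> R) (k0 k1 m M C1 : R).
Hypothesis m0 : (0 < m)%R.
Hypothesis M1 : (M <= 1)%R.
Hypothesis heP : log_holder eP k0 k1 m M C1.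
Local Notation phi := (phase k0 k1).

Lemma source_decay (g : R -> \bar R) :
  (forall t, 0 <= g t) -> (forall s t : R, (0 < s)%R -> (s <= t)%R -> g t <= g s) ->
  \int[lebesgue_1 R]_(t in `]0%R, +oo[%classic) modular_integrand eP Q g t <= 1 ->
  exists x : int -> R, [/\ (forall k, 0 <= x k <= sourceK)%R,
    (forall k, g (expR k%:~R) = (expR (C1 + 1 - phi k) * x k)%:E) &
    isum (fun k => (x k `^ w k)%:E) <= decayC%:E].
Proof.
move=> g0 gni mod1.
pose X k := (expR (phi k - (C1 + 1)))%:E * g (expR k%:~R).
have X0 k : 0 <= X k by rewrite mule_ge0// lee_fin expR_ge0.
have Xb (r : R) k : (0 <= r)%R -> r%:E <= X k -> (r <= sourceK)%R.
  (* A sequence with one nonzero entry tests the bound before [X k] is known to be finite. *)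
  move=> r0 rX; pose y j := if j == k then r else 0%R.
  have -> : r = y k by rewrite /y eqxx.
  apply: (source_bound eP Q k0 k1 m M C1 w0 w1 lo hi C2 m0 M1 lo0 heP hQ g y) => // j.
    by rewrite /y; case: ifP.
  by rewrite /y; case: ifP => [/eqP -> //|_]; exact: X0.
have K1 : (1 <= sourceK)%R by exact: sourceK_ge1.
have K0 : (0 <= sourceK)%R by exact: le_trans K1.
have Xfin k : X k \is a fin_num.
  rewrite ge0_fin_numE// ltey; apply/eqP => Xk.
  have := @Xb (sourceK + 1)%R k; rewrite Xk leey addr_ge0// => /(_ isT isT).
  by rewrite leNgt ltrDl ltr01.
pose x k := fine (X k).
have xE k : (x k)%:E = X k by rewrite fineK.
have x0 k : (0 <= x k)%R by rewrite -lee_fin xE.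
have xX k : (x k)%:E <= (expR (phi k - (C1 + 1)))%:E * g (expR k%:~R) by rewrite xE.
have xK k : (x k <= sourceK)%R by apply: (@Xb _ k) => //; rewrite xE.
exists x; split.
- by move=> k; rewrite x0 xK.
- move=> k; rewrite EFinM xE /X muleA -EFinM -expRD.
  by rewrite (_ : _ + _ = 0)%R ?expR0 ?mul1e//; ring.
set C' := expR (C2 * (ln sourceK + lo^-1)).
have C'0 : (0 < C')%R by exact: expR_gt0.
(* The part of [x k]^ w
   k[beyond the error of]powR_perturb[, divided by its constant; it lies below]x k [^ Q t] on the
   shell. *)
pose c k : \bar R := (Num.max 0 ((x k `^ w k - expR (- `|k|%N%:R)) / C'))%:E.
have c0 k : 0 <= c k by rewrite lee_fin le_max lexx.
have ci : (1 - expR (-1))%:E * isum c <= 1.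
  apply: le_trans mod1; apply: isum_shell_le_integral => //.
    by move=> t _; rewrite mule_ge0 ?poweR_ge0// lee_fin powR_ge0.
  have [C20 _ _ ae2] := hQ.
  have aem := modular_lower eP Q k0 k1 m M C1 w0 w1 lo hi C2 m0 M1 lo0 heP hQ g x g0 gni x0 xX.
  apply: (ae_imply2 _ _ _ _ _ _ _ ae2 aem) => t h2 h j jt.
  apply: le_trans (h j jt); rewrite lee_wpmul2l ?lee_fin ?expR_ge0// /c.
  have [t0 /andP[tj1 tj2]] := shellP _ _ jt; have [/andP[q1 _] q2] := h2 t0.
  rewrite ge_max powR_ge0/= ler_pdivrMr// lerBlDr mulrC.
  apply: (powR_perturb lo sourceK C2) => //.
  - by rewrite x0 xK.
  - by rewrite distrC; apply: q2; rewrite ler_norml; apply/andP; split; lra.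
have isc : isum c <= massC%:E.
  by rewrite /massC -[leRHS]mul1e lee_pdivlMr ?massC_gt0// muleC.
have e0 k : 0 <= (expR (- `|k|%N%:R : R))%:E by rewrite lee_fin expR_ge0.
apply: (@le_trans _ _ (isum (fun k => C'%:E * c k + (expR (- `|k|%N%:R))%:E))).
  apply: le_isum => k; first by rewrite lee_fin powR_ge0.
  rewrite /c -EFinM -EFinD lee_fin -lerBlDr mulrC -ler_pdivrMr//.
  by rewrite le_max lexx orbT.
rewrite isumD//; last by move=> k; rewrite mule_ge0// lee_fin ltW.
rewrite isumZl// /decayC EFinD EFinM; apply: leeD; last exact: isum_expR1.
by rewrite lee_wpmul2l// lee_fin ltW.
Qed.

End decay.

(** * From sequences back to a bounded modular *)

Section target.
Context {R : realType}.
Variables (eP Q V : R -> R) (g k0 k1 m M C1 w0 w1 lo hi C2 n0 n1 vlo vhi C3 : R).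
Hypothesis g0 : (0 < g)%R.
Hypothesis gm : (g < m)%R.
Hypothesis M1 : (M < 1)%R.
Hypothesis lo0 : (0 < lo)%R.
Hypothesis vlo0 : (0 < vlo)%R.
Hypothesis heP : log_holder eP k0 k1 m M C1.
Hypothesis hQ : log_holder Q w0 w1 lo hi C2.
Hypothesis hV : log_holder V n0 n1 vlo vhi C3.
Hypothesis wn0 : (w0 <= n0)%R.
Hypothesis wn1 : (w1 <= n1)%R.
Local Notation phi := (phase k0 k1).
Local Notation w := (side w0 w1).
Local Notation nu := (side n0 n1).

Let m0 : (0 < m)%R. Proof. exact: lt_trans gm. Qed.

Let wlo k : (lo <= w k)%R.
Proof. by case: hQ => _ a b _; case/andP: (side_itv _ _ _ _ k a b). Qed.

Let w_gt0 k : (0 < w k)%R. Proof. exact: lt_le_trans (wlo k). Qed.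

Let wnu k : (w k <= nu k)%R.
Proof. by rewrite /side; case: ifP. Qed.

Let vlonu k : (vlo <= nu k)%R.
Proof. by case: hV => _ a b _; case/andP: (side_itv _ _ _ _ k a b). Qed.

Definition gainC : R := expR (C3 * (ln 1 + vlo^-1)).

Definition totalC (A : R) : R := (expR 1 * (gainC * A + geom (1 / 2)) + 1)%R.

(** [A]^ lo^-1[bounds every]sg k[, so dividing by it brings the sequence below 1. Dividing further
    by]totalC A [^ vlo^-1] gains at least the factor [1 / totalC A] in the modular, as the exponents
    are at least [vlo]. *)
Definition targetC (A D : R) : R :=
  (D * expR (C1 + 1) * A `^ lo^-1 * totalC A `^ vlo^-1)%R.

Lemma totalC_ge1 A : (1 <= A)%R -> (1 <= totalC A)%R.
Proof.
move=> A1; rewrite /totalC lerDr mulr_ge0 ?expR_ge0// addr_ge0//.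
  by rewrite mulr_ge0 ?expR_ge0// (le_trans ler01).
by rewrite ltW// geom_gt0// divr_gt0.
Qed.

Lemma targetC_gt0 A D : (1 <= A)%R -> (0 < D)%R -> (0 < targetC A D)%R.
Proof.
move=> A1 D0; have T1 := totalC_ge1 A A1.
by rewrite /targetC !mulr_gt0 ?expR_gt0 ?powR_gt0//; exact: lt_le_trans ltr01 _.
Qed.

(** An upper bound for the nonincreasing [h] comes from the left endpoint, so the value at e^k
    governs shell [k + 1]. *)
Lemma target_pointwise (h : R -> \bar R) (z : int -> R) :
  (forall t, 0 <= h t) -> (forall s t : R, (0 < s)%R -> (s <= t)%R -> h t <= h s) ->
  (forall k, 0 <= z k)%R ->
  (forall k, (expR (phi k - g * k%:~R + (C1 + 1)))%:E * h (expR k%:~R) <= (z k)%:E) ->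
  {ae lebesgue_1 R, forall t k, shell (k + 1)%R t ->
    modular_integrand (fun t => eP t - g)%R V h t <=
    (expR (- k%:~R))%:E * ((z k) `^ (V t))%:E}.
Proof.
move=> h0 hni z0 hz.
have [C10 _ _ ae1] := heP; have [_ _ _ ae2] := hV.
apply: (ae_imply2 _ _ _ _ _ _ _ ae1 ae2) => t h1 h2 k kt.
have [t0 /andP[kt1 kt2]] := shellP _ _ kt; rewrite intrD/= addrK in kt1 kt2.
have [/andP[e1 e2] e3] := h1 t0; have [/andP[q1 q2] q3] := h2 t0.
have tk1 : (`|ln t - k%:~R| <= 1)%R by rewrite ler_norml; apply/andP; split; lra.
have z01 : (0 <= eP t <= 1)%R.
  by rewrite (le_trans (ltW m0) e1)/=; exact: le_trans (ltW M1).
have := phase_dist k0 k1 C1 (ln t) (eP t) k C10 z01 tk1 (e3 k tk1).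
rewrite ler_norml => /andP[d1 d2].
have Vt0 : (0 <= V t)%R by apply: le_trans q1; exact: ltW.
rewrite /modular_integrand.
have -> : (t `^ (V t * (eP t - g) - 1) =
    expR (- ln t) * expR ((ln t * eP t - g * ln t) * V t))%R.
  by rewrite -expRD /powR gt_eqF//; congr expR; ring.
rewrite EFinM -muleA; apply: lee_pmul.
- by rewrite lee_fin expR_ge0.
- by rewrite mule_ge0 ?poweR_ge0// lee_fin expR_ge0.
- by rewrite lee_fin ler_expR lerN2 ltW.
rewrite expRM -2!poweR_EFin -poweRM//.
apply: le_poweR => //; first by rewrite mule_ge0// lee_fin expR_ge0.
apply: le_trans (hz k); apply: lee_pmul => //.
  rewrite lee_fin ler_expR.
  have : (g * k%:~R <= g * ln t)%R by rewrite ler_wpM2l ?ltW.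
  by lra.
apply: hni; first exact: expR_gt0.
by rewrite -[leRHS](@lnK _ t) ?posrE// ler_expR ltW.
Qed.

(** After normalisation the sequence is at most 1, hence [V t] may be frozen to [nu k] and then
    lowered to [w k], which only increases the powers. *)
Lemma target_bound (A D : R) (h : R -> \bar R) (sg : int -> R) :
  (1 <= A)%R -> (0 < D)%R ->
  (forall t, 0 <= h t) -> (forall s t : R, (0 < s)%R -> (s <= t)%R -> h t <= h s) ->
  (forall k, 0 < sg k)%R -> isum (fun k => (sg k `^ w k)%:E) <= A%:E ->
  (forall k, h (expR k%:~R) <=
    (D / targetC A D * sg k * expR (g * k%:~R - phi k))%:E) ->
  \int[lebesgue_1 R]_(t in `]0%R, +oo[%classic)
     modular_integrand (fun t => eP t - g)%R V h t <= 1.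
Proof.
move=> A1 D0 h0 hni sg0 sgA hsg.
have A0 : (0 < A)%R by exact: lt_le_trans A1.
have T1 := totalC_ge1 A A1; have T0 : (0 < totalC A)%R by exact: lt_le_trans T1.
have [L1 L1E] : exists L, L = (A `^ lo^-1)%R by eexists.
have [L2 L2E] : exists L, L = (totalC A `^ vlo^-1)%R by eexists.
have L1ge1 : (1 <= L1)%R.
  by rewrite L1E -[X in (X <= _)%R](powRr0 A) ler_powR// invr_ge0 ltW.
have L2ge1 : (1 <= L2)%R.
  by rewrite L2E -[X in (X <= _)%R](powRr0 (totalC A)) ler_powR// invr_ge0 ltW.
have L10 : (0 < L1)%R by exact: lt_le_trans L1ge1.
have L20 : (0 < L2)%R by exact: lt_le_trans L2ge1.
have sgL k : (sg k <= L1)%R.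
  have : (sg k `^ w k <= A)%R.
    rewrite -lee_fin; apply: le_trans sgA.
    by apply: (term_le_isum (fun k => (sg k `^ w k)%:E)) => j; rewrite lee_fin powR_ge0.
  move=> sA; rewrite L1E -[leLHS]powRr1 ?(ltW (sg0 k))// -(@mulfV _ (w k)) ?gt_eqF// powRrM.
  apply: (@le_trans _ _ (A `^ (w k)^-1)%R).
    by apply: ge0_ler_powR; rewrite ?nnegrE ?powR_ge0 ?invr_ge0 ?(ltW (w_gt0 k)) ?(ltW A0).
  by rewrite ler_powR// lef_pV2 ?posrE.
pose z k := (sg k / L1 / L2)%R.
have z0 k : (0 <= z k)%R by rewrite /z !divr_ge0 ?ltW.
have hz k : (expR (phi k - g * k%:~R + (C1 + 1)))%:E * h (expR k%:~R) <= (z k)%:E.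
  apply: (@le_trans _ _ ((expR (phi k - g * k%:~R + (C1 + 1)))%:E *
     (D / targetC A D * sg k * expR (g * k%:~R - phi k))%:E)).
    by rewrite lee_wpmul2l// lee_fin expR_ge0.
  rewrite -EFinM lee_fin /z /targetC -L1E -L2E le_eqVlt; apply/orP; left; apply/eqP.
  have -> : (phi k - g * k%:~R + (C1 + 1) = - (g * k%:~R - phi k) + (C1 + 1))%R by ring.
  rewrite [expR (- _ + _)]expRD expRN.
  by field; rewrite !gt_eqF ?expR_gt0.
(* Shell [k] is governed by index [k - 1]; [expR 1] compensates for e^(-(k - 1)) in place of
   e^(-k). *)
pose c k : \bar R := (expR 1 / totalC A *
   (gainC * sg (k - 1)%R `^ w (k - 1)%R + expR (- `|k - 1|%N%:R)))%:E.
have eT0 : (0 <= expR 1 / totalC A)%R by rewrite divr_ge0 ?expR_ge0 ?(ltW T0).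
have c0 k : 0 <= c k.
  by rewrite lee_fin mulr_ge0// addr_ge0 ?mulr_ge0 ?expR_ge0 ?powR_ge0.
apply: (@le_trans _ _ (isum c)).
  apply: integral_le_isum_shell => //.
    by move=> t _; rewrite mule_ge0 ?poweR_ge0// lee_fin powR_ge0.
  have [C30 _ _ ae2] := hV.
  apply: (ae_imply2 _ _ _ _ _ _ _ ae2 (target_pointwise h z h0 hni z0 hz)) => t h2 hh j jt.
  have [k jE] : exists k, j = (k + 1)%R by exists (j - 1)%R; rewrite subrK.
  have kt : shell (k + 1)%R t by rewrite -jE.
  apply: le_trans; first by rewrite jE in jt *; exact: hh kt.
  rewrite jE /c addrK.
  have [t0 /andP[tk1 tk2]] := shellP _ _ kt; rewrite intrD/= addrK in tk1 tk2.
  have [/andP[v1 v2] v3] := h2 t0.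
  rewrite -!EFinM lee_fin intrD/= opprD expRD -[leRHS]mulrA ler_wpM2l ?expR_ge0//.
  rewrite !mulrA -expRD addNr expR0 mul1r.
  have zk : (sg k / L1 / L2 = sg k / L1 * L2^-1)%R by [].
  rewrite /z powRM ?invr_ge0 ?divr_ge0 ?(ltW (sg0 k)) ?(ltW L10) ?(ltW L20)//.
  have V0 : (0 < V t)%R by exact: lt_le_trans v1.
  have L2V : (L2^-1 `^ V t <= (totalC A)^-1)%R.
    rewrite -(powR_inv1 (ltW L20)) -powRrM mulN1r powRN lef_pV2 ?posrE ?powR_gt0//.
    rewrite L2E -powRrM -[leLHS]powRr1 ?(ltW T0)// ler_powR// mulrC ler_pdivlMr// mul1r//.
  have sL1 : (sg k / L1 <= 1)%R by rewrite ler_pdivrMr// mul1r.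
  have sL0 : (0 < sg k / L1)%R by rewrite divr_gt0.
  rewrite mulrC; apply: ler_pM; rewrite ?powR_ge0//.
  apply: (@le_trans _ _ (gainC * (sg k / L1) `^ nu k + expR (- `|k|%N%:R))%R).
    apply: (powR_perturb vlo 1 C3) => //.
    - by rewrite (ltW sL0) sL1.
    - by apply: v3; rewrite ler_norml; apply/andP; split; lra.
  rewrite lerD2r ler_wpM2l ?expR_ge0//.
  apply: (@le_trans _ _ ((sg k / L1) `^ w k)%R); first by rewrite ger_powR// sL0 sL1.
  apply: ge0_ler_powR; rewrite ?nnegrE ?(ltW (w_gt0 k)) ?(ltW sL0) ?(ltW (sg0 k))//.
  by rewrite ler_pdivrMr// ler_peMr// ltW.
pose c1 k : \bar R := (gainC * sg k `^ w k + expR (- `|k|%N%:R))%:E.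
have c10 k : 0 <= c1 k by rewrite lee_fin addr_ge0 ?mulr_ge0 ?expR_ge0 ?powR_ge0.
have -> : isum c = (expR 1 / totalC A)%:E * isum c1.
  by rewrite -(isum_shift c1 1)// -isumZl//; congr isum; apply/funext => k; rewrite -EFinM.
have c1A : isum c1 <= (gainC * A + geom (1 / 2))%:E.
  have s0 k : 0 <= (sg k `^ w k)%:E by rewrite lee_fin powR_ge0.
  have -> : isum c1 = gainC%:E * isum (fun k => (sg k `^ w k)%:E) +
      isum (fun k => (expR (- `|k|%N%:R))%:E).
    rewrite -isumZl// -isumD.
    - by [].
    - by move=> k; rewrite mule_ge0// lee_fin expR_ge0.
    - by move=> k; rewrite lee_fin expR_ge0.
  rewrite EFinD EFinM; apply: leeD; last exact: isum_expR1.
  by rewrite lee_wpmul2l// lee_fin expR_ge0.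
apply: (@le_trans _ _ ((expR 1 / totalC A)%:E * (gainC * A + geom (1 / 2))%:E)).
  by rewrite lee_wpmul2l.
rewrite -EFinM lee_fin mulrAC ler_pdivrMr// [leRHS]mul1r.
by rewrite /totalC lerDl ler01.
Qed.

End target.

(** * Transfer between modulars of nonincreasing functions *)

Section core_1d.
Context {R : realType}.
Variables (eP Q V : R -> R) (g k0 k1 m M C1 w0 w1 lo hi C2 n0 n1 vlo vhi C3 : R).
Hypothesis g0 : (0 < g)%R.
Hypothesis gm : (g < m)%R.
Hypothesis M1 : (M < 1)%R.
Hypothesis lo0 : (0 < lo)%R.
Hypothesis vlo0 : (0 < vlo)%R.
Hypothesis heP : log_holder eP k0 k1 m M C1.
Hypothesis hQ : log_holder Q w0 w1 lo hi C2.
Hypothesis hV : log_holder V n0 n1 vlo vhi C3.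
Hypothesis wn0 : (w0 <= n0)%R.
Hypothesis wn1 : (w1 <= n1)%R.

(* [sg k] is a geometrically smoothed version of the sequence
   [x k ~ e^(k/p) gF (e^k)], so that at the scale [e^k] the function gF lies below
   power functions to which the transfer hypothesis applies. *)
Lemma modular_transfer (eps C0 : R) : (0 < eps)%R -> (0 < C0)%R ->
  exists2 L : R, (0 < L)%R & forall gF h : R -> \bar R,
    (forall t, 0 <= gF t) -> (forall s t : R, (0 < s)%R -> (s <= t)%R -> gF t <= gF s) ->
    (forall t, 0 <= h t) -> (forall s t : R, (0 < s)%R -> (s <= t)%R -> h t <= h s) ->
    (forall t s : R, (0 < s)%R ->
      (forall i : nat, gF (expR (t - i%:R)) < (s * expR ((M + eps) * i%:R))%:E) ->
      (forall i : nat, gF (expR (t + i%:R)) < (s * expR (- ((m - eps) * i%:R)))%:E) ->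
      h (expR t) <= (C0 / L * s * expR (g * t))%:E) ->
    \int[lebesgue_1 R]_(t in `]0%R, +oo[%classic) modular_integrand eP Q gF t <= 1 ->
    \int[lebesgue_1 R]_(t in `]0%R, +oo[%classic)
      modular_integrand (fun t => eP t - g)%R V h t <= 1.
Proof.
move=> eps0 C00.
have m0 : (0 < m)%R by exact: lt_trans gm.
have d0 : (0 < eps * lo)%R by rewrite mulr_gt0.
(* A loss at rate [eps] in the levels becomes, after taking powers [w k >= lo], a decay at rate at
   least [d]. *)
pose d := (eps * lo)%R.
have [A AE] : exists A, A = Num.max 1%R (smoothC lo hi d (decayC lo C2)) by eexists.
have A1 : (1 <= A)%R by rewrite AE le_max lexx.
have [D DE] : exists D, D = (2 * C0 * expR (C1 + 1))%R by eexists.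
have D0 : (0 < D)%R by rewrite DE !mulr_gt0 ?expR_gt0.
have L0 := @targetC_gt0 R C1 lo vlo C3 A D A1 D0.
exists (targetC C1 lo vlo C3 A D) => // gF h gF0 gFni h0 hni transfer mod1.
have [C20 lw0 lw1 _] := hQ; have [C10 mk0 mk1 _] := heP.
have wlo k : (lo <= side w0 w1 k)%R by case/andP: (side_itv _ _ _ _ k lw0 lw1).
have w_gt0 k : (0 < side w0 w1 k)%R by exact: lt_le_trans (wlo k).
have [x [xK gFx xsum]] := source_decay Q w0 w1 lo hi C2 lo0 hQ eP k0 k1 m M C1 m0 (ltW M1)
  heP gF gF0 gFni mod1.
have x0 k : (0 <= x k)%R by case/andP: (xK k).
pose T k j : \bar R := (expR (- (d * `|k - j|%N%:R)) * x j `^ side w0 w1 k)%:E.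
have T0 k j : 0 <= T k j by rewrite lee_fin mulr_ge0 ?expR_ge0 ?powR_ge0.
(* The first term keeps [S k] positive, so that the level [sg k] is positive even if [x]
   vanishes. *)
pose S k := (expR (- `|k|%N%:R))%:E + isum (T k).
have S0 k : 0 < S k.
  by rewrite (@lt_le_trans _ _ (expR (- `|k|%N%:R))%:E) ?lte_fin ?expR_gt0// leeDl// isum_ge0.
have SA : isum S <= A%:E.
  apply: (@le_trans _ _ (smoothC lo hi d (decayC lo C2))%:E).
    exact: (smooth_decay Q w0 w1 lo hi C2 lo0 hQ d _ x d0 xK xsum).
  by rewrite lee_fin AE le_max lexx orbT.
have Sfin k : S k \is a fin_num.
  rewrite ge0_fin_numE ?(ltW (S0 k))//.
  have := @term_le_isum _ S k (fun k => ltW (S0 k)).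
  by move/le_trans/(_ SA)/le_lt_trans; apply; rewrite ltry.
have fS0 k : (0 < fine (S k))%R by rewrite -lte_fin fineK.
pose sg k := (fine (S k) `^ (side w0 w1 k)^-1)%R.
have sg0 k : (0 < sg k)%R by rewrite powR_gt0.
have sgS k : ((sg k `^ side w0 w1 k)%:E = S k).
  by rewrite /sg -powRrM mulVf ?gt_eqF// powRr1 ?(ltW (fS0 k))// fineK.
have xsg k j : (x j <= expR (eps * `|k - j|%N%:R) * sg k)%R.
  rewrite mulrC -ler_pdivrMr ?expR_gt0// -expRN.
  set X := (X in (X <= _)%R).
  have X0 : (0 <= X)%R by rewrite mulr_ge0 ?expR_ge0.
  rewrite -[leLHS]powRr1// -(@mulfV _ (side w0 w1 k)) ?gt_eqF// powRrM.
  apply: ge0_ler_powR; rewrite ?nnegrE ?powR_ge0 ?invr_ge0 ?(ltW (w_gt0 k)) ?(ltW (fS0 k))//.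
  rewrite -lee_fin fineK//.
  apply: (@le_trans _ _ (T k j)); last first.
    apply: (le_trans (term_le_isum (T k) j (T0 k))).
    by rewrite /S leeDr// lee_fin expR_ge0.
  rewrite lee_fin /X powRM ?expR_ge0// mulrC -expRM ler_wpM2r ?powR_ge0//.
  rewrite ler_expR mulNr lerN2 /d mulrAC ler_wpM2l//.
  by rewrite mulr_ge0// ltW.
have tr k : h (expR k%:~R) <=
    (D / targetC C1 lo vlo C3 A D * sg k * expR (g * k%:~R - phase k0 k1 k))%:E.
  (* The factor 2 makes the inequalities required by the transfer hypothesis strict. *)
  pose s := (2 * expR (C1 + 1) * sg k * expR (- phase k0 k1 k))%R.
  have s0 : (0 < s)%R by rewrite /s !mulr_gt0 ?expR_gt0.
  have -> : (D / targetC C1 lo vlo C3 A D * sg k * expR (g * k%:~R - phase k0 k1 k) =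
      C0 / targetC C1 lo vlo C3 A D * s * expR (g * k%:~R))%R.
    by rewrite expRD DE /s; ring.
  have gFs (j : int) (z : R) : (eps * `|k - j|%N%:R + phase k0 k1 k - phase k0 k1 j <= z)%R ->
      gF (expR j%:~R) < (s * expR z)%:E.
    move=> jz; rewrite gFx lte_fin.
    apply: (@le_lt_trans _ _ (expR (C1 + 1 - phase k0 k1 j) * (expR (eps * `|k - j|%N%:R) * sg k)))%R.
      by rewrite ler_wpM2l ?expR_ge0.
    apply: (@le_lt_trans _ _ (expR (C1 + 1) * sg k * expR (- phase k0 k1 k) * expR z))%R.
      rewrite mulrA -expRD [leRHS](_ : _ = expR (C1 + 1 - phase k0 k1 k + z) * sg k)%R.
        rewrite ler_wpM2r ?(ltW (sg0 k))// ler_expR.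
        by lra.
      by rewrite !expRD; ring.
    rewrite /s ltr_pM2r ?expR_gt0// ltr_pM2r ?expR_gt0// ltr_pM2r//.
    by rewrite ltr_pMl ?expR_gt0// ltr1n.
  (* Over [i] steps the phase rises by at most [M i] and at least [m i]; with the smoothing loss
     [eps i] this gives the slopes [M + eps] to the left and [m - eps] to the right. *)
  apply: transfer => // i.
    have -> : (k%:~R - i%:R = (k - i%:Z)%:~R :> R)%R by rewrite intrB.
    apply: gFs; have := phase_mono k0 k1 m M (k - i%:Z)%R i mk0 mk1.
    rewrite subrK => /andP[_ h2].
    have -> : `|k - (k - i%:Z)%R|%N = i by rewrite opprB addrCA subrr addr0.
    by rewrite mulrDl -addrA [leLHS]addrC lerD2r.
  have -> : (k%:~R + i%:R = (k + i%:Z)%:~R :> R)%R by rewrite intrD.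
  apply: gFs; have := phase_mono k0 k1 m M k i mk0 mk1 => /andP[h1 _].
  have -> : `|k - (k + i%:Z)%R|%N = i by rewrite opprD addrA subrr sub0r abszN.
  by rewrite mulrBl opprB -addrA lerD2l -[leLHS]opprB lerN2.
apply: (target_bound eP Q V g k0 k1 m M C1 w0 w1 lo hi C2 n0 n1 vlo vhi C3 g0 gm M1 lo0 vlo0
  heP hQ hV wn0 wn1 A D h sg) => //.
by rewrite (_ : (fun k => _) = S)//; apply/funext.
Qed.

End core_1d.

(** * Exponents and rearrangements *)

Section exponents.
Context {R : realType}.
Implicit Types (p e : R -> R).

Lemma ae_lebesgue_pos (P : R -> Prop) : {ae @lebesgue_pos R, forall t, P t} ->
  {ae lebesgue_1 R, forall t, (0 < t)%R -> P t}.
Proof.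
move=> [N [mN N0 sN]]; exists (N `&` `]0%R, +oo[%classic); split.
- by apply: measurableI => //; exact: measurable_pos.
- exact: N0.
move=> t /= nP; have [t0|t0] := pselect (0 < t)%R; last by exfalso; apply: nP => /t0.
by split; [apply: sN => Pt; apply: nP|rewrite /= in_itv/= t0].
Qed.

(** Projecting the limits of an exponent into its essential range moves them no farther from its
    values there, so the limits themselves need not be located. *)
Definition clamp (lo hi x : R) : R := Num.max lo (Num.min hi x).

Lemma clamp_itv (lo hi x : R) : (lo <= hi)%R -> (lo <= clamp lo hi x <= hi)%R.
Proof. by move=> lh; rewrite /clamp le_max lexx ge_max lh ge_min lexx. Qed.

Lemma clamp_dist (lo hi x y : R) : (lo <= y <= hi)%R ->
  (`|y - clamp lo hi x| <= `|y - x|)%R.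
Proof.
move=> /andP[ly yh]; rewrite /clamp /Num.min /Num.max.
have [hx|xh] := ltP hi x.
  have -> : (`|y - x| = x - y)%R by rewrite distrC ger0_norm//; lra.
  by case: ltP => l; rewrite ler_norml; apply/andP; split; lra.
case: ltP => l //; have -> : (`|y - x| = y - x)%R by rewrite ger0_norm//; lra.
by rewrite ler_norml; apply/andP; split; lra.
Qed.

Lemma log_holder_P0 p (lo hi : R) : P0 p -> (0 < lo)%R -> lo%:E <= exponent_inf p ->
  exponent_sup p <= hi%:E -> (lo <= hi)%R ->
  exists e0 e1 C : R, log_holder p e0 e1 lo hi C.
Proof.
move=> [_ _ _ _ [a [b [_ _ [C C0 [Ca Cb]]]]]] lo0 /ess_infP plo /ess_supP phi lohi.
exists (clamp lo hi a), (clamp lo hi b), (3 * C + 2 * (hi - lo))%R.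
split; [by lra|exact: clamp_itv|exact: clamp_itv|].
apply: (ae_imply2 _ _ _ _ _ _ _ (ae_lebesgue_pos _ plo) (ae_lebesgue_pos _ phi)) => t h1 h2 t0.
have {}h1 := h1 t0; have {}h2 := h2 t0; rewrite !lee_fin/= in h1 h2.
have lph : (lo <= p t <= hi)%R by rewrite h1 h2.
split=> // k tk.
have k0 : (0 <= `|k|%N%:R :> R)%R by [].
rewrite ler_pdivlMr ?ltr_pwDl//.
have fin (x l : R) : (`|p t - x| <= C / l)%R -> (1 <= l)%R -> (`|k|%N%:R - 1 <= l)%R ->
    (`|p t - clamp lo hi x| * (1 + `|k|%N%:R) <= 3 * C + 2 * (hi - lo))%R.
  move=> pl l1 kl; apply: (@le_trans _ _ (C / l * (3 * l))%R).
    apply: ler_pM => //; first exact: le_trans (clamp_dist _ _ _ _ lph) pl.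
    by lra.
  by rewrite mulrCA divfK ?gt_eqF ?(lt_le_trans ltr01)//; lra.
move: tk; rewrite ler_norml => /andP[tk1 tk2].
have e2 : (2 < expR 1 :> R)%R by rewrite (le_lt_trans _ (expR_gt1Dx _)).
have [k1|k1] := leP k 0%R; rewrite /side.
  have kE : (k%:~R = - `|k|%N%:R :> R)%R.
    by move: k1; case: (k) => [[|j]|j] //= _; rewrite ?oppr0// NegzE mulrNz.
  (* For |k| >= 2 one has t <= 1/e < 1/2, within the range of the condition at 0. For [k = 0] and
     [k = -1] the trivial bound [hi - lo] is used. *)
  rewrite k1; have [k2|k2] := leP 2%N `|k|%N.
    have k2R : (2 <= `|k|%N%:R :> R)%R by rewrite ler_nat.
    apply: (fin a (- ln t)%R); [|lra|lra].
    apply: Ca; rewrite t0/= -[t]lnK ?posrE//.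
    rewrite (@le_lt_trans _ _ (expR (-1)))//; first by rewrite ler_expR; lra.
    by rewrite expRN ltf_pV2 ?posrE ?expR_gt0.
  have k2R : (`|k|%N%:R <= 1 :> R)%R by rewrite lern1 -ltnS.
  have /andP[c1 c2] := clamp_itv lo hi a lohi.
  apply: (@le_trans _ _ ((hi - lo) * 2)%R); last by lra.
  apply: ler_pM => //; last by lra.
  by rewrite ler_norml; apply/andP; split; lra.
rewrite [(k <= 0)%R]leNgt k1/=.
have kE : (k%:~R = `|k|%N%:R :> R)%R by move: k1; case: (k) => [[|j]|j].
have et0 : (0 < expR 1 + t)%R by rewrite addr_gt0// expR_gt0.
apply: (fin b (ln (expR 1 + t)%R)); first exact: Cb.
  by rewrite -[leLHS]expRK ler_ln ?posrE ?expR_gt0// lerDl ltW.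
apply: (@le_trans _ _ (ln t)); first by lra.
by rewrite ler_ln ?posrE// lerDr expR_ge0.
Qed.

(** Covers 1/(sigma p), sigma q and sigma v at once, all Lipschitz images of [p] or [q]. *)
Lemma log_holder_comp e (e0 e1 lo hi C K lo' hi' : R) (F : R -> R) : (0 <= K)%R ->
  log_holder e e0 e1 lo hi C ->
  (forall x, (lo <= x <= hi)%R -> (lo' <= F x <= hi')%R) ->
  (forall x y, (lo <= x <= hi)%R -> (lo <= y <= hi)%R -> (`|F x - F y| <= K * `|x - y|)%R) ->
  log_holder (F \o e) (F e0) (F e1) lo' hi' (K * C).
Proof.
move=> K0 [C0 h0 h1 aee] Flh FK; split; [exact: mulr_ge0|exact: Flh|exact: Flh|].
apply: (ae_imply2 _ _ _ _ _ _ _ aee aee) => t ht _ t0; have [et ek] := ht t0.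
split=> [|k tk]; first exact: Flh.
have -> : side (F e0) (F e1) k = F (side e0 e1 k) by rewrite /side; case: ifP.
apply: (le_trans (FK _ _ et (side_itv _ _ _ _ k h0 h1))).
by rewrite -mulrA ler_wpM2l//; exact: ek.
Qed.

Lemma inv_lipschitz (lo x y : R) : (0 < lo)%R -> (lo <= x)%R -> (lo <= y)%R ->
  (`|x^-1 - y^-1| <= lo^-1 ^+ 2 * `|x - y|)%R.
Proof.
move=> lo0 lx ly; have x0 : (0 < x)%R by exact: lt_le_trans lx.
have y0 : (0 < y)%R by exact: lt_le_trans ly.
have -> : (x^-1 - y^-1 = x^-1 * y^-1 * (y - x))%R by field; rewrite !gt_eqF.
rewrite normrM distrC ler_wpM2r// ger0_norm ?mulr_ge0 ?invr_ge0 ?(ltW x0) ?(ltW y0)//.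
by rewrite expr2 ler_pM ?invr_ge0 ?(ltW x0) ?(ltW y0)// lef_pV2 ?posrE.
Qed.

End exponents.

(** * Rearrangements, superlevel sets and norms *)

Section rearrangement.
Context {R : realType} {n : nat}.
Implicit Types f : Rn R n -> \bar R.

Lemma rearrangement_ge0 f t : 0 <= rearrangement f t.
Proof. by apply: le_ereal_inf_tmp => _ [s [s0 _] <-]; rewrite lee_fin. Qed.

Lemma rearrangement_ni f (s t : R) : (s <= t)%R -> rearrangement f t <= rearrangement f s.
Proof.
move=> st; apply: le_ereal_inf => _ [y [y0 fy] <-]; exists y => //; split=> //.
by apply: (le_trans fy); rewrite lee_fin.
Qed.

(** Strictness yields an admissible level below [y], so the infimum need not be attained. *)
Lemma rearrangement_lt f (t y : R) : rearrangement f t < y%:E ->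
  lebesgue_n [set x | y%:E < `|f x|] <= t%:E.
Proof.
move=> /ereal_inf_lt[_ [s [s0 fs] <-]] sy.
by apply: le_trans fs; apply: le_lebesgue_n => x /=; apply: lt_trans.
Qed.

Lemma rearrangement_le f (t y : R) : (0 <= y)%R ->
  lebesgue_n [set x | y%:E < `|f x|] <= t%:E -> rearrangement f t <= y%:E.
Proof. by move=> y0 fy; apply: ereal_inf_lbound; exists y. Qed.

End rearrangement.

Lemma measurable_lr_sum {R : realType} n (r : R) (f : nat -> Rn R n -> \bar R) :
  (forall j, measurable_fun [set: Rn R n] (f j)) ->
  measurable_fun [set: Rn R n] (lr_sum r f).
Proof.
move=> mf; apply: (measurableT_comp (measurable_poweR _)).
apply: ge0_emeasurable_sum => [j x _ _|j _]; first exact: poweR_ge0.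
by apply: (measurableT_comp (measurable_poweR _)).
Qed.

Lemma weak_frac_maximal {R : realType} (n : nat) (g a c : R) : (0 < n)%N ->
  (0 < g < c)%R -> (c < 1)%R -> (0 < a < 1)%R ->
  exists2 C : R, (0 < C)%R & forall (b r s t : R) (f : nat -> Rn R n -> \bar R),
    (b / n%:R = g)%R -> (1 < r)%R -> (0 < s)%R ->
    (forall j, measurable_fun [set: Rn R n] (f j)) ->
    let F := lr_sum r (fun j x => `|f j x|) in
    (forall i : nat, lebesgue_n [set x | (s * expR (a * i%:R))%:E < F x] <=
       (expR (t - i%:R))%:E) ->
    (forall i : nat, lebesgue_n [set x | (s * expR (- (c * i%:R)))%:E < F x] <=
       (expR (t + i%:R))%:E) ->
    lebesgue_n [set x | (C * s * expR (g * t))%:E < lr_sum r (fun j => frac_maximal b (f j)) x]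
      <= (expR t)%:E.
Proof.
move=> n0 /andP[g0 gc] c1 a01.
have nR0 : (0 < n%:R :> R)%R by rewrite ltr0n.
pose C := Num.max 1%R (dominationC (n := n) g * weakC g a c)%R.
exists C; first by rewrite lt_max ltr01.
move=> b r s t f bg r1 s0 mf F Fa Fc.
have F0 x : 0 <= F x by exact: poweR_ge0.
have mF : measurable_fun [set: Rn R n] F.
  by apply: measurable_lr_sum => j; apply: (measurableT_comp (@abse_measurable R _)).
have bn : (b < n%:R)%R.
  by rewrite -[ltRHS]mul1r -ltr_pdivrMr// bg (lt_trans gc).
have g0c : (0 < g < c)%R by rewrite g0 gc.
apply: le_trans (weak_potential n0 g a c s t F mF F0 g0c c1 a01 s0 Fa Fc).
apply: le_lebesgue_n => x /=; rewrite !ltNge; apply: contra => pot.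
apply: (le_trans (lr_sum_frac_maximal_le n0 b r t f x bn r1 mf)); rewrite bg.
apply: (@le_trans _ _ ((dominationC (n := n) g)%:E *
   (weakC g a c * s * expR (g * t))%:E)).
  by rewrite lee_wpmul2l// lee_fin expR_ge0.
rewrite -EFinM lee_fin !mulrA ler_wpM2r ?expR_ge0// ler_wpM2r ?(ltW s0)//.
by rewrite le_max lexx orbT.
Qed.

(** Each admissible [l] for [F] gives the admissible [L * l] for [G]; if there is none, the
    right-hand side is +oo. *)
Lemma lorentz_norm_le {R : realType} (n : nat) (p q u v : R -> R) (L : R)
    (F G : Rn R n -> \bar R) : (0 < L)%R ->
  (forall l : R, (0 < l)%R -> lorentz_modular p q (fun x => l^-1%:E * F x) <= 1 ->
     lorentz_modular u v (fun x => (L * l)^-1%:E * G x) <= 1) ->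
  lorentz_norm u v G <= L%:E * lorentz_norm p q F.
Proof.
move=> L0 FG; rewrite -lee_pdivrMl//; apply: le_ereal_inf_tmp => _ [l [l0 Fl] <-].
rewrite lee_pdivrMl// -EFinM; apply: ereal_inf_lbound.
exists (L * l)%R; last by [].
by split; [exact: mulr_gt0|exact: FG].
Qed.

Lemma exponent_bounds {R : realType} (p : R -> R) (p0 b : R) : P0 p -> (0 < p0)%R ->
  p0%:E < exponent_inf p -> exponent_sup p < b%:E ->
  exists lo hi e0 e1 C : R, [/\ (p0 < lo)%R, (hi < b)%R & log_holder p e0 e1 lo hi C].
Proof.
move=> P0p p00 pinf psup; have [_ i0 is_ _ _] := P0p.
have ifin : exponent_inf p \is a fin_num.
  by rewrite ge0_fin_numE ?(ltW i0)// (le_lt_trans is_)// (lt_trans psup)// ltry.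
have sfin : exponent_sup p \is a fin_num.
  by rewrite ge0_fin_numE ?(lt_trans psup) ?ltry// (le_trans _ is_)// ltW.
exists (fine (exponent_inf p)), (fine (exponent_sup p)).
have lo0 : (p0 < fine (exponent_inf p))%R by rewrite -lte_fin fineK.
have := @log_holder_P0 R p (fine (exponent_inf p)) (fine (exponent_sup p)) P0p.
rewrite !fineK// (lt_trans p00 lo0) !lexx -lee_fin !fineK// => /(_ isT isT isT is_).
move=> [e0 [e1 [C h]]]; exists e0, e1, C; split=> //.
by rewrite -lte_fin fineK.
Qed.

Theorem proposition33 (R : realType) (n : nat) (alpha r : R) (p q : R -> R)
    (halpha : (0 < alpha < n%:R)%R) (hr : (1 < r)%R)
    (hp : P0 p) (hq : P0 q)
    (hpn : 0 < exponent_sup p < (n%:R / alpha)%:E)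
    (hqn : 0 < exponent_sup q < (n%:R / alpha)%:E)
    (p0 : R) (hp0 : (0 < p0)%R)
    (hp0' : p0%:E < mine (n%:R / (n%:R + alpha))%:E
                         (mine (exponent_inf p) (exponent_inf q)))
    (sigma : R) (hsigma : (p0^-1 < sigma)%R) :
  let u := sobolev_exponent n alpha p in
  let v := sobolev_exponent n alpha q in
  exists2 C : R, (0 < C)%R &
    forall f : nat -> Rn R n -> \bar R,
      (forall j, measurable_fun [set: Rn R n] (f j)) ->
      lorentz_norm (fun t => sigma * u t)%R (fun t => sigma * v t)%R
        (lr_sum r (fun j => frac_maximal (alpha / sigma) (f j))) <=
      C%:E * lorentz_norm (fun t => sigma * p t)%R (fun t => sigma * q t)%R
        (lr_sum r (fun j x => `|f j x|)).
Proof.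
move=> u v; have /andP[a0 an] := halpha.
have nR0 : (0 < n%:R :> R)%R by exact: lt_trans an.
have n0 : (0 < n)%N by rewrite -(ltr0n R).
have s0 : (0 < sigma)%R by apply: lt_trans hsigma; rewrite invr_gt0.
move: hp0'; rewrite !lt_min => /and3P[_ hpi hqi].
have /andP[_ hps] := hpn; have /andP[_ hqs] := hqn.
have [lp [hip [a [b [C1 [lp0 hipb Lp]]]]]] := exponent_bounds p p0 _ hp hp0 hpi hps.
have [lq [hiq [a' [b' [C2 [lq0 hiqb Lq]]]]]] := exponent_bounds q p0 _ hq hp0 hqi hqs.
have lp_gt0 : (0 < lp)%R by exact: lt_trans lp0.
have lq_gt0 : (0 < lq)%R by exact: lt_trans lq0.
have lphip : (lp <= hip)%R by case: Lp => _ /andP[h /(le_trans h)].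
have lqhiq : (lq <= hiq)%R by case: Lq => _ /andP[h /(le_trans h)].
have hip_gt0 : (0 < hip)%R by exact: lt_le_trans lphip.
have hiq_gt0 : (0 < hiq)%R by exact: lt_le_trans lqhiq.
have [dl dlE] : exists dl : R, dl = (alpha / n%:R)%R by eexists.
have dl0 : (0 < dl)%R by rewrite dlE divr_gt0.
have dlV (x : R) : (0 < x)%R -> (x < n%:R / alpha)%R -> (dl < x^-1)%R.
  by move=> x0 xb; rewrite dlE -[ltLHS]invf_div ltf_pV2 ?posrE// divr_gt0.
have dlp := dlV _ hip_gt0 hipb; have dlq := dlV _ hiq_gt0 hiqb.
(* Here [sigma > 1/p0] and [p0 < p_-] give the slope bound [M < 1]. *)
have slp : (1 < sigma * lp)%R.
  rewrite -ltr_pdivrMr//; apply: lt_trans hsigma.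
  by rewrite div1r ltf_pV2 ?posrE.
have LeP : exists C, log_holder (fun t => (sigma * p t)^-1)%R (sigma * a)^-1%R (sigma * b)^-1%R
    (sigma * hip)^-1%R (sigma * lp)^-1%R C.
  eexists; apply: (log_holder_comp p a b lp hip C1 (sigma^-1 * lp^-1 ^+ 2) _ _
    (fun x => (sigma * x)^-1)%R _ Lp).
  - by rewrite mulr_ge0 ?exprn_ge0 ?invr_ge0 ?(ltW s0) ?(ltW lp_gt0).
  - move=> x /andP[lx xh]; have x0 : (0 < x)%R by exact: lt_le_trans lx.
    by rewrite !lef_pV2 ?posrE ?mulr_gt0// !ler_pM2l// xh lx.
  - move=> x y /andP[lx xh] /andP[ly yh].
    rewrite !invfM -mulrBr normrM ger0_norm ?invr_ge0 ?(ltW s0)// -mulrA.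
    by rewrite ler_wpM2l ?invr_ge0 ?(ltW s0)//; exact: inv_lipschitz.
have LQ : exists C, log_holder (fun t => sigma * q t)%R (sigma * a')%R (sigma * b')%R
    (sigma * lq)%R (sigma * hiq)%R C.
  eexists; apply: (log_holder_comp q a' b' lq hiq C2 sigma _ _ (fun x => sigma * x)%R _ Lq).
  - exact: ltW.
  - by move=> x /andP[lx xh]; rewrite !ler_pM2l// lx xh.
  - by move=> x y _ _; rewrite -mulrBr normrM gtr0_norm.
pose V (x : R) := (sigma * (x^-1 - dl)^-1)%R.
have Vden x : (lq <= x <= hiq)%R -> (0 < hiq^-1 - dl <= x^-1 - dl)%R.
  move=> /andP[lx xh]; have x0 : (0 < x)%R by exact: lt_le_trans lx.
  by rewrite subr_gt0 dlq lerD2r lef_pV2 ?posrE.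
have LV : exists C, log_holder (fun t => sigma * v t)%R (V a') (V b') (V lq) (V hiq) C.
  eexists; rewrite (_ : (fun t => _) = V \o q); last first.
    by apply/funext => t; rewrite /v /sobolev_exponent -dlE.
  apply: (log_holder_comp q a' b' lq hiq C2
    (sigma * ((hiq^-1 - dl)^-1 ^+ 2 * lq^-1 ^+ 2)) _ _ V _ Lq).
  - by rewrite mulr_ge0 ?(ltW s0)// mulr_ge0 ?sqr_ge0.
  - move=> x xh; have /andP[hd0 hdx] := Vden x xh; have /andP[lx xh'] := xh.
    have x0 : (0 < x)%R by exact: lt_le_trans lx.
    have d0 : (0 < x^-1 - dl)%R by exact: lt_le_trans hdx.
    have ld0 : (0 < lq^-1 - dl)%R.
      by apply: (lt_le_trans d0); rewrite lerD2r lef_pV2 ?posrE.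
    by rewrite /V !ler_pM2l// !lef_pV2 ?posrE// hdx lerD2r lef_pV2 ?posrE// lx.
  - move=> x y xh yh; have /andP[hd0 hdx] := Vden x xh; have /andP[_ hdy] := Vden y yh.
    have /andP[lx _] := xh; have /andP[ly _] := yh.
    rewrite /V -mulrBr normrM gtr0_norm// -mulrA ler_wpM2l ?(ltW s0)//.
    apply: (le_trans (inv_lipschitz _ _ _ hd0 hdx hdy)).
    rewrite -[leRHS]mulrA ler_wpM2l ?sqr_ge0//.
    have -> : (x^-1 - dl - (y^-1 - dl) = x^-1 - y^-1)%R by ring.
    exact: inv_lipschitz.
(* Since [dl > 0], the exponent [sigma v] dominates [sigma q]; applied to the limits, this is the
   ordering needed in the transfer. *)
have xV x : (lq <= x <= hiq)%R -> (sigma * x <= V x)%R.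
  move=> xh; have /andP[hd0 hdx] := Vden x xh; have /andP[lx _] := xh.
  have x0 : (0 < x)%R by exact: lt_le_trans lx.
  rewrite /V ler_pM2l// -[leLHS]invrK lef_pV2 ?posrE ?invr_gt0// ?gerBl ?(ltW dl0)//.
  exact: lt_le_trans hdx.
have {LeP}[D1 LeP] := LeP; have {LQ}[D2 LQ] := LQ; have {LV}[D3 LV] := LV.
have ha' : (lq <= a' <= hiq)%R by case: Lq.
have hb' : (lq <= b' <= hiq)%R by case: Lq.
set m := (sigma * hip)^-1%R in LeP; set M := (sigma * lp)^-1%R in LeP.
have [g gE] : exists g : R, g = (alpha / sigma / n%:R)%R by eexists.
have gdl : g = (sigma^-1 * dl)%R by rewrite gE dlE; ring.
have g0 : (0 < g)%R by rewrite gdl mulr_gt0 ?invr_gt0.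
have gm : (g < m)%R by rewrite gdl /m invfM ltr_pM2l ?invr_gt0.
have M1 : (M < 1)%R by rewrite /M invf_lt1// (lt_trans ltr01).
have mM : (m <= M)%R by case: LeP => _ /andP[h /(le_trans h)].
(* Half of the smaller gap, so that both [M + eps < 1] and [g < m - eps] survive. *)
have [eps epsE] : exists eps : R, eps = (Num.min (1 - M) (m - g) / 2)%R by eexists.
have eps0 : (0 < eps)%R by rewrite epsE divr_gt0// lt_min !subr_gt0 M1 gm.
have eps2 : (2 * eps <= Num.min (1 - M) (m - g))%R by rewrite epsE mulrC divfK.
move: eps2; rewrite le_min => /andP[epsM epsm].
have a01 : (0 < M + eps < 1)%R by apply/andP; split; lra.
have gc : (0 < g < m - eps)%R by apply/andP; split; lra.
have c1 : (m - eps < 1)%R by lra.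
have [C0 C00 weak] := weak_frac_maximal n g (M + eps) (m - eps) n0 gc c1 a01.
have slq0 : (0 < sigma * lq)%R by exact: mulr_gt0.
have hlq : (lq <= lq <= hiq)%R by rewrite lexx.
have Vlq0 : (0 < V lq)%R by apply: (lt_le_trans slq0); exact: xV.
have [L L0 transf] := modular_transfer _ _ _ g _ _ m M D1 _ _ _ _ D2 _ _ _ _ D3
  g0 gm M1 slq0 Vlq0 LeP LQ LV (xV _ ha') (xV _ hb') eps C0 eps0 C00.
exists L; first exact: L0.
move=> f mf; apply: (lorentz_norm_le _ _ _ _ _ _ _ _ L0) => l l0 mod1.
set F := lr_sum r _ in mod1; set G := lr_sum r _.
have F0 x : 0 <= F x by exact: poweR_ge0.
have G0 x : 0 <= G x by exact: poweR_ge0.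
have il0 : (0 < l^-1)%R by rewrite invr_gt0.
have iLl0 : (0 < (L * l)^-1)%R by rewrite invr_gt0 mulr_gt0.
(* The reciprocal of [sigma u] is that of [sigma p] minus [g]; the identity holds at every [t] by
   the convention for the inverse of 0. *)
rewrite /lorentz_modular; under eq_integral => t _.
  have -> : (sigma * v t / (sigma * u t) = sigma * v t * ((sigma * p t)^-1 - g))%R.
    by rewrite /u /sobolev_exponent -dlE !invfM invrK gdl mulrBr.
  over.
apply: (transf (rearrangement (fun x => l^-1%:E * F x))) mod1.
- by move=> t; exact: rearrangement_ge0.
- by move=> s t _; exact: rearrangement_ni.
- by move=> t; exact: rearrangement_ge0.
- by move=> s t _; exact: rearrangement_ni.
move=> t s s_gt0 Fa Fc.
have scale (k : R) (H : Rn R n -> \bar R) (y : R) : (0 < k)%R -> (forall x, 0 <= H x) ->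
    [set x | y%:E < `|k^-1%:E * H x|] = [set x | (k * y)%:E < H x].
  move=> k0 H0; apply/seteqP; split=> x /=.
    rewrite gee0_abs ?mule_ge0 ?lee_fin ?invr_ge0 ?(ltW k0)//.
    by rewrite EFinM -lte_pdivlMl.
  rewrite gee0_abs ?mule_ge0 ?lee_fin ?invr_ge0 ?(ltW k0)//.
  by rewrite EFinM -lte_pdivlMl.
apply: rearrangement_le.
  by rewrite !mulr_ge0 ?expR_ge0 ?invr_ge0 ?ltW.
rewrite scale ?mulr_gt0//.
(* The constant [L] cancels, and the norm parameter [l] only rescales the level [s] of the weak
   estimate. *)
have -> : (L * l * (C0 / L * s * expR (g * t)) = C0 * (l * s) * expR (g * t))%R.
  by field; rewrite gt_eqF.
apply: weak => //; first exact: mulr_gt0.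
  by move=> i; have := rearrangement_lt _ _ _ (Fa i); rewrite scale// mulrA.
by move=> i; have := rearrangement_lt _ _ _ (Fc i); rewrite scale// mulrA.
Qed.
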